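(* Let $E$ be an arbitrary (countable, not necessarily row-finite) directed graph and $K$ a field. Then the socle of the Leavitt path algebra $L_K(E)$ is zero or a locally matricial $K$-algebra, and there are a countable set $I$ and elements $n_i\in\mathbb{N}\cup\{\infty\}$ ($i\in I$) such that, as $K$-algebras, $$\mathrm{Soc}(L_K(E))\cong\bigoplus_{i\in I}\mathbb{M}_{n_i}(K).$$
   Context: A graph $E=(E^0,E^1,r,s)$ consists of countable sets $E^0$ (vertices), $E^1$ (edges) and maps $r,s:E^1\to E^0$ (range, source). A vertex $v$ is regular if $s^{-1}(v)$ is finite and nonempty. The Leavitt path algebra $L_K(E)$ is the $K$-algebra generated by a set $\{v: v\in E^0\}$ of pairwise orthogonal idempotents and elements $\{e,e^*: e\in E^1\}$ subject to: (1) $s(e)e=er(e)=e$; (2) $r(e)e^*=e^*s(e)=e^*$; (3) $e^*e'=\delta_{e,e'}r(e)$; (4) $v=\sum_{s(e)=v}ee^*$ for every regular vertex $v$. $L_K(E)$ is semiprime; the socle $\mathrm{Soc}(R)$ of a semiprime ring $R$ is the sum of all its minimal left ideals (which equals the sum of all its minimal right ideals), and is $0$ if there are none. $\mathbb{M}_\infty(K)$ denotes the ring of matrices of countably infinite size over $K$ with only finitely many nonzero entries. A matricial algebra is a finite direct product of full matrix algebras (of finite size) over $K$; a locally matricial algebra is a direct limit of matricial algebras (with not necessarily unital connecting homomorphisms). ''Countable'' means finite (possibly empty) or countably infinite. *)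

(* Defs.v *)
From HB Require Import structures.
From mathcomp Require Import all_boot all_order all_algebra.
From mathcomp Require Import finmap boolp classical_sets functions cardinality.
From mathcomp Require Import fsbigop.

Set Implicit Arguments.
Unset Strict Implicit.
Unset Printing Implicit Defensive.

Import Order.TTheory GRing.Theory.

Local Open Scope classical_set_scope.
Local Open Scope ring_scope.

HB.mixin Record Lmodule_isNuAlgebra (K : fieldType) A of GRing.Lmodule K A := {
  numul : A -> A -> A;
  numulA : associative numul;
  numulDl : left_distributive numul +%R;
  numulDr : right_distributive numul +%R;
  numulZl : forall (a : K) (x y : A), numul (a *: x) y = a *: numul x y;
  numulZr : forall (a : K) (x y : A), numul x (a *: y) = a *: numul x y
}.

#[short(type="nuAlgType")]
HB.structure Definition NuAlgebra (K : fieldType) :=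
  {A of GRing.Lmodule K A & Lmodule_isNuAlgebra K A}.

Notation "x ** y" := (numul x y) (at level 40, left associativity) : ring_scope.

Section NuAlgebraTheory.
Variables (K : fieldType) (A : nuAlgType K).

Lemma numul0r (x : A) : 0 ** x = 0.
Proof. by rewrite -{1}(scale0r 0) numulZl scale0r. Qed.

Lemma numulr0 (x : A) : x ** 0 = 0.
Proof. by rewrite -{1}(scale0r 0) numulZr scale0r. Qed.

Lemma numul_sumr (I : Type) (r : seq I) (x : A) (F : I -> A) :
  x ** (\sum_(i <- r) F i) = \sum_(i <- r) x ** F i.
Proof.
by elim: r => [|i r IHr]; rewrite ?big_nil ?numulr0 // !big_cons numulDr IHr.
Qed.

End NuAlgebraTheory.

Definition nualg_hom (K : fieldType) (A B : nuAlgType K) (f : A -> B) : Prop :=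
  linear f /\ {morph f : x y / x ** y}.

Definition nualg_isom (K : fieldType) (A B : nuAlgType K) : Prop :=
  exists f : A -> B, nualg_hom f /\ bijective f.

Definition subalg_closed (K : fieldType) (A : nuAlgType K) (S : set A) : Prop :=
  [/\ S 0, (forall x y, S x -> S y -> S (x + y)),
      (forall (a : K) x, S x -> S (a *: x)) &
      (forall x y, S x -> S y -> S (x ** y))].

Section Subalgebra.
Variables (K : fieldType) (A : nuAlgType K) (S : set A).

Definition subalg_pred of subalg_closed S : {pred A} := fun x => x \in S.

Variable clS : subalg_closed S.

Lemma subalg_subsemimod : subsemimod_closed (subalg_pred clS).
Proof.
have [S0 SD SZ _] := clS.
split; first split.
- exact/mem_set.
- by move=> x y /set_mem Sx /set_mem Sy; apply/mem_set/SD.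
- by move=> a x /set_mem Sx; apply/mem_set/SZ.
Qed.

HB.instance Definition _ :=
  GRing.isSubmodClosed.Build K A (subalg_pred clS) subalg_subsemimod.

Record subalg := Subalg { subalg_val : A; _ : subalg_val \in subalg_pred clS }.

HB.instance Definition _ := [isSub for subalg_val].
HB.instance Definition _ := [Choice of subalg by <:].
HB.instance Definition _ := [SubChoice_isSubLmodule of subalg by <:].

Lemma subalg_mul_subproof (x y : subalg) :
  val x ** val y \in subalg_pred clS.
Proof.
have [_ _ _ SM] := clS.
by apply/mem_set/SM; apply/set_mem; [case: x | case: y].
Qed.

Definition subalg_mul (x y : subalg) : subalg :=
  Subalg (subalg_mul_subproof x y).

Lemma subalg_mulA : associative subalg_mul.
Proof. by move=> x y z; apply/val_inj/numulA. Qed.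

Lemma subalg_mulDl : left_distributive subalg_mul +%R.
Proof. by move=> x y z; apply/val_inj/numulDl. Qed.

Lemma subalg_mulDr : right_distributive subalg_mul +%R.
Proof. by move=> x y z; apply/val_inj/numulDr. Qed.

Lemma subalg_mulZl (a : K) (x y : subalg) :
  subalg_mul (a *: x) y = a *: subalg_mul x y.
Proof. by apply/val_inj/numulZl. Qed.

Lemma subalg_mulZr (a : K) (x y : subalg) :
  subalg_mul x (a *: y) = a *: subalg_mul x y.
Proof. by apply/val_inj/numulZr. Qed.

HB.instance Definition _ := Lmodule_isNuAlgebra.Build K subalg
  subalg_mulA subalg_mulDl subalg_mulDr subalg_mulZl subalg_mulZr.

End Subalgebra.

Definition dirprod (K : fieldType) (I : Type) (A : I -> nuAlgType K) : Type :=
  forall i, A i.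

Section DirectProduct.
Variables (K : fieldType) (I : Type) (A : I -> nuAlgType K).
Implicit Types f g h : dirprod A.

HB.instance Definition _ := gen_eqMixin (dirprod A).
HB.instance Definition _ := gen_choiceMixin (dirprod A).

Definition dirprod_zero : dirprod A := fun=> 0.
Definition dirprod_opp f : dirprod A := fun i => - f i.
Definition dirprod_add f g : dirprod A := fun i => f i + g i.
Definition dirprod_scale (a : K) f : dirprod A := fun i => a *: f i.
Definition dirprod_mul f g : dirprod A := fun i => f i ** g i.

Lemma dirprod_addA : associative dirprod_add.
Proof.
by move=> f g h; apply: functional_extensionality_dep => i; exact: addrA.
Qed.

Lemma dirprod_addC : commutative dirprod_add.
Proof.
by move=> f g; apply: functional_extensionality_dep => i; exact: addrC.
Qed.

Lemma dirprod_add0 : left_id dirprod_zero dirprod_add.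
Proof.
by move=> f; apply: functional_extensionality_dep => i; exact: add0r.
Qed.

Lemma dirprod_addN : left_inverse dirprod_zero dirprod_opp dirprod_add.
Proof.
by move=> f; apply: functional_extensionality_dep => i; exact: addNr.
Qed.

HB.instance Definition _ := GRing.isZmodule.Build (dirprod A)
  dirprod_addA dirprod_addC dirprod_add0 dirprod_addN.

Lemma dirprod_scaleA a b f :
  dirprod_scale a (dirprod_scale b f) = dirprod_scale (a * b) f.
Proof. by apply: functional_extensionality_dep => i; exact: scalerA. Qed.

Lemma dirprod_scale1 : left_id 1 dirprod_scale.
Proof.
by move=> f; apply: functional_extensionality_dep => i; exact: scale1r.
Qed.

Lemma dirprod_scaleDr : right_distributive dirprod_scale +%R.
Proof.
by move=> a f g; apply: functional_extensionality_dep => i; exact: scalerDr.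
Qed.

Lemma dirprod_scaleDl f : {morph dirprod_scale^~ f : a b / a + b}.
Proof.
by move=> a b; apply: functional_extensionality_dep => i; exact: scalerDl.
Qed.

HB.instance Definition _ := GRing.Zmodule_isLmodule.Build K (dirprod A)
  dirprod_scaleA dirprod_scale1 dirprod_scaleDr dirprod_scaleDl.

Lemma dirprod_mulA : associative dirprod_mul.
Proof.
by move=> f g h; apply: functional_extensionality_dep => i; exact: numulA.
Qed.

Lemma dirprod_mulDl : left_distributive dirprod_mul +%R.
Proof.
by move=> f g h; apply: functional_extensionality_dep => i; exact: numulDl.
Qed.

Lemma dirprod_mulDr : right_distributive dirprod_mul +%R.
Proof.
by move=> f g h; apply: functional_extensionality_dep => i; exact: numulDr.
Qed.

Lemma dirprod_mulZl (a : K) f g : dirprod_mul (a *: f) g = a *: dirprod_mul f g.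
Proof. by apply: functional_extensionality_dep => i; exact: numulZl. Qed.

Lemma dirprod_mulZr (a : K) f g : dirprod_mul f (a *: g) = a *: dirprod_mul f g.
Proof. by apply: functional_extensionality_dep => i; exact: numulZr. Qed.

HB.instance Definition _ := Lmodule_isNuAlgebra.Build K (dirprod A)
  dirprod_mulA dirprod_mulDl dirprod_mulDr dirprod_mulZl dirprod_mulZr.

Definition fin_supp : set (dirprod A) :=
  [set f | finite_set [set i | f i <> 0]].

Lemma fin_supp_closed : subalg_closed fin_supp.
Proof.
split.
- rewrite /fin_supp /=; apply: sub_finite_set (@finite_set0 I).
  by move=> i /=; apply.
- move=> f g ff fg; rewrite /fin_supp /=.
  have : finite_set ([set i | f i <> 0] `|` [set i | g i <> 0]).
    by rewrite finite_setU.
  apply: sub_finite_set => i /= fgi.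
  have [fi0|] := pselect (f i = 0); last by left.
  by right=> gi0; apply: fgi; rewrite -[0]addr0 -{1}fi0 -gi0.
- move=> a f; apply: sub_finite_set => i /= afi fi0.
  by apply: afi; rewrite -[0](scaler0 _ a) -fi0.
- move=> f g ff _; apply: sub_finite_set ff => i /= fgi fi0.
  by apply: fgi; rewrite -[0](numul0r (g i)) -fi0.
Qed.

Definition dirsum : nuAlgType K := subalg fin_supp_closed.

End DirectProduct.

Section FiniteMatrices.
Variables (K : fieldType) (n : nat).

Let mxmulZl (a : K) (x y : 'M[K]_n) : (a *: x) *m y = a *: (x *m y).
Proof. by rewrite scalemxAl. Qed.
Let mxmulZr (a : K) (x y : 'M[K]_n) : x *m (a *: y) = a *: (x *m y).
Proof. by rewrite scalemxAr. Qed.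

HB.instance Definition _ := Lmodule_isNuAlgebra.Build K 'M[K]_n
  (@mulmxA K n n n n) (@mulmxDl K n n n) (@mulmxDr K n n n) mxmulZl mxmulZr.

End FiniteMatrices.

Section InfiniteMatrices.
Variable K : fieldType.

Definition finite_entries : {pred nat -> nat -> K^o} :=
  fun x => `[< finite_set [set ij : nat * nat | x ij.1 ij.2 <> 0] >].

Lemma finite_entriesP (x : nat -> nat -> K^o) :
  x \in finite_entries <->
  exists N, forall i j, (N <= i)%N || (N <= j)%N -> x i j = 0.
Proof.
split=> [/asboolP /finite_seqP [s xs]|[N xN]].
  exists (\max_(ij <- s) maxn ij.1 ij.2).+1 => i j ltN.
  have [//|xij] := pselect (x i j = 0).
  have: [set` s] (i, j) by rewrite -xs.
  move=> /= sij; pose F (ij : nat * nat) := maxn ij.1 ij.2.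
  have := @leq_bigmax_seq _ s xpredT F (i, j) sij isT.
  by rewrite geq_max leqNgt [X in _ && X]leqNgt -negb_or ltN.
apply/asboolP/(sub_finite_set _ (finite_setX (finite_II N) (finite_II N))).
move=> [i j] /= xij; split=> /=; rewrite ltnNge; apply: contra_notN xij => le.
  by apply: xN; rewrite le.
by apply: xN; rewrite le orbT.
Qed.

Lemma finite_entries_subsemimod : subsemimod_closed finite_entries.
Proof.
split; first split.
- by apply/finite_entriesP; exists 0%N.
- move=> x y /finite_entriesP [M xM] /finite_entriesP [N yN].
  apply/finite_entriesP; exists (maxn M N) => i j.
  rewrite !geq_max => MN; rewrite /GRing.add /= /GRing.add /=.
  rewrite xM ?yN ?addr0 //.
    by case/orP: MN => /andP [_ ->]; rewrite ?orbT.
  by case/orP: MN => /andP [-> _]; rewrite ?orbT.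
- move=> a x /finite_entriesP [M xM]; apply/finite_entriesP.
  exists M => i j ij; rewrite [LHS]/(a * x i j) xM //; exact: mulr0.
Qed.

HB.instance Definition _ :=
  GRing.isSubmodClosed.Build K (nat -> nat -> K^o) finite_entries
    finite_entries_subsemimod.

Record infmx := Infmx {
  infmx_val :> nat -> nat -> K^o;
  _ : infmx_val \in finite_entries }.

HB.instance Definition _ := [isSub for infmx_val].
HB.instance Definition _ := [Choice of infmx by <:].
HB.instance Definition _ := [SubChoice_isSubLmodule of infmx by <:].

Implicit Types x y z : infmx.

(* [K^o] is [K] seen as a module over itself; entries are computed with in
   [K]. *)
Definition infmx_entry x (i j : nat) : K := x i j.
Local Notation "x @( i , j )" := (infmx_entry x i j)
  (at level 10, format "x @( i ,  j )").

(* The sum over the whole of nat has only finitely many nonzero terms. *)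
Definition infmx_mul_fun x y : nat -> nat -> K^o :=
  fun i j => \sum_(k \in [set: nat]) (x@(i, k) * y@(k, j)).

Lemma infmxP x y : (forall i j, x@(i, j) = y@(i, j)) -> x = y.
Proof.
by move=> xy; apply/val_inj/funext => i; apply/funext => j; exact: xy.
Qed.

Lemma infmxDE x y i j : (x + y)@(i, j) = x@(i, j) + y@(i, j).
Proof. by []. Qed.

Lemma infmxZE a x i j : (a *: x)@(i, j) = a * x@(i, j).
Proof. by []. Qed.

Lemma infmx_bound x :
  exists N, forall i j, (N <= i)%N || (N <= j)%N -> x@(i, j) = 0.
Proof. by apply/finite_entriesP; case: x. Qed.

Lemma infmx_mul_funE x y N i j :
  (forall k, (N <= k)%N -> x@(i, k) = 0) ->
  infmx_mul_fun x y i j = \sum_(k < N) x@(i, k) * y@(k, j).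
Proof.
move=> xN; rewrite /infmx_mul_fun.
rewrite -(big_mkord xpredT (fun k => x@(i, k) * y@(k, j))).
rewrite (fsbigE (index_iota 0 N)) ?iota_uniq //.
  by apply: eq_bigl => k; rewrite in_setT.
by move=> k _; rewrite mem_index_iota /= -leqNgt => /xN ->; rewrite mul0r.
Qed.

Lemma infmx_mul_subproof x y : infmx_mul_fun x y \in finite_entries.
Proof.
have [M xM] := infmx_bound x; have [N yN] := infmx_bound y.
apply/finite_entriesP; exists (maxn M N) => i j.
rewrite !geq_max => MN; rewrite (@infmx_mul_funE _ _ M).
  apply: big1 => k _; case/orP: MN => /andP [Mi Nj].
    by rewrite xM ?Mi // mul0r.
  by rewrite yN ?Nj ?orbT // mulr0.
by move=> k Mk; rewrite xM // Mk orbT.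
Qed.

Definition infmx_mul x y : infmx := Infmx (infmx_mul_subproof x y).

Lemma infmx_mulE x y N i j :
  (forall k, (N <= k)%N -> x@(i, k) = 0) ->
  (infmx_mul x y)@(i, j) = \sum_(k < N) x@(i, k) * y@(k, j).
Proof. exact: infmx_mul_funE. Qed.

Lemma infmx_row_bound x :
  exists N, forall i k, (N <= k)%N -> x@(i, k) = 0.
Proof.
by have [N xN] := infmx_bound x; exists N => i k Nk; rewrite xN // Nk orbT.
Qed.

Lemma infmx_mulA : associative infmx_mul.
Proof.
move=> x y z; apply: infmxP => i j.
have [M xM] := infmx_row_bound x; have [N yN] := infmx_row_bound y.
rewrite (infmx_mulE _ _ (xM i)) (@infmx_mulE _ _ N); last first.
  move=> k Nk; rewrite (infmx_mulE _ _ (xM i)) big1 // => l _.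
  by rewrite yN // mulr0.
transitivity (\sum_(l < M) \sum_(k < N) x@(i, l) * y@(l, k) * z@(k, j)).
  apply: eq_bigr => l _; rewrite (infmx_mulE _ _ (yN l)) mulr_sumr.
  by apply: eq_bigr => k _; rewrite mulrA.
rewrite exchange_big; apply: eq_bigr => k _.
by rewrite (infmx_mulE _ _ (xM i)) mulr_suml.
Qed.

Lemma infmx_mulDl : left_distributive infmx_mul +%R.
Proof.
move=> x y z; apply: infmxP => i j.
have [M xM] := infmx_row_bound x; have [N yN] := infmx_row_bound y.
have xB k : (maxn M N <= k)%N -> x@(i, k) = 0.
  by rewrite geq_max => /andP [Mk _]; rewrite xM.
have yB k : (maxn M N <= k)%N -> y@(i, k) = 0.
  by rewrite geq_max => /andP [_ Nk]; rewrite yN.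
rewrite infmxDE (infmx_mulE _ _ xB) (infmx_mulE _ _ yB) -big_split.
rewrite (@infmx_mulE _ _ (maxn M N)); last first.
  by move=> k Bk; rewrite infmxDE xB // yB // addr0.
by apply: eq_bigr => k _; rewrite infmxDE mulrDl.
Qed.

Lemma infmx_mulDr : right_distributive infmx_mul +%R.
Proof.
move=> x y z; apply: infmxP => i j; have [M xM] := infmx_row_bound x.
rewrite infmxDE !(infmx_mulE _ _ (xM i)) -big_split.
by apply: eq_bigr => k _; rewrite infmxDE mulrDr.
Qed.

Lemma infmx_mulZl (a : K) x y : infmx_mul (a *: x) y = a *: infmx_mul x y.
Proof.
apply: infmxP => i j; have [M xM] := infmx_row_bound x.
rewrite infmxZE (infmx_mulE _ _ (xM i)) mulr_sumr (@infmx_mulE _ _ M).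
  by apply: eq_bigr => k _; rewrite infmxZE mulrA.
by move=> k Mk; rewrite infmxZE xM // mulr0.
Qed.

Lemma infmx_mulZr (a : K) x y : infmx_mul x (a *: y) = a *: infmx_mul x y.
Proof.
apply: infmxP => i j; have [M xM] := infmx_row_bound x.
rewrite infmxZE !(infmx_mulE _ _ (xM i)) mulr_sumr.
by apply: eq_bigr => k _; rewrite infmxZE mulrCA.
Qed.

HB.instance Definition _ := Lmodule_isNuAlgebra.Build K infmx
  infmx_mulA infmx_mulDl infmx_mulDr infmx_mulZl infmx_mulZr.

End InfiniteMatrices.

(* [None] stands for the size "infinity". *)
Definition matalg (K : fieldType) (n : option nat) : nuAlgType K :=
  if n is Some m then 'M[K]_m else infmx K.

(* Products are nonempty and matrix sizes positive, so the zero algebra is not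
   matricial. *)
Definition matricial (K : fieldType) (A : nuAlgType K) : Prop :=
  exists (m : nat) (n : 'I_m.+1 -> nat),
    nualg_isom A (dirprod (fun i => 'M[K]_((n i).+1) : nuAlgType K)).

Section DirectLimit.
Variables (K : fieldType) (d : Order.disp_t) (D : porderType d).
Variables (A : D -> nuAlgType K).
Variables (phi : forall i j : D, (i <= j)%O -> A i -> A j).

Definition directed : Prop :=
  (exists i : D, True) /\
  forall i j : D, exists k, (i <= k)%O /\ (j <= k)%O.

Definition direct_system : Prop :=
  [/\ forall i j (ij : (i <= j)%O), nualg_hom (phi ij),
      forall i (ii : (i <= i)%O) x, phi ii x = x &
      forall i j k (ij : (i <= j)%O) (jk : (j <= k)%O) (ik : (i <= k)%O) x,
        phi jk (phi ij x) = phi ik x].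

Definition cocone (B : nuAlgType K) (f : forall i, A i -> B) : Prop :=
  (forall i, nualg_hom (f i)) /\
  forall i j (ij : (i <= j)%O) x, f j (phi ij x) = f i x.

Definition is_direct_limit (L : nuAlgType K)
    (psi : forall i, A i -> L) : Prop :=
  cocone psi /\
  forall (B : nuAlgType K) (f : forall i, A i -> B), cocone f ->
    exists! h : L -> B, nualg_hom h /\ forall i x, h (psi i x) = f i x.

End DirectLimit.

Definition locally_matricial (K : fieldType) (L : nuAlgType K) : Prop :=
  exists (d : Order.disp_t) (D : porderType d) (A : D -> nuAlgType K)
         (phi : forall i j : D, (i <= j)%O -> A i -> A j)
         (psi : forall i, A i -> L),
    [/\ directed D, forall i, matricial (A i), direct_system phi &
        is_direct_limit phi psi].

Section Socle.
Variables (K : fieldType) (A : nuAlgType K).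

(* Left ideals are those of the underlying ring: no closure under scalars is
   required, and A need not have a unit. *)
Definition left_ideal (J : set A) : Prop :=
  [/\ J 0, (forall x y, J x -> J y -> J (x - y)) &
      (forall a x, J x -> J (a ** x))].

Definition minimal_left_ideal (J : set A) : Prop :=
  [/\ left_ideal J, J <> [set 0] &
      forall J' : set A, left_ideal J' -> J' `<=` J ->
        J' = [set 0] \/ J' = J].

Definition socle : set A :=
  [set x | exists2 s : seq A,
     (forall y, y \in s -> exists2 J, minimal_left_ideal J & J y) &
     x = \sum_(y <- s) y].

Lemma minimal_left_idealZ (a : K) (J : set A) : a != 0 ->
  minimal_left_ideal J -> minimal_left_ideal [set x | J (a^-1 *: x)].
Proof.
have scl_ideal (b : K) J' : left_ideal J' -> left_ideal [set x | J' (b *: x)].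
  case=> J0 JB JM; split=> /=.
  - by rewrite scaler0.
  - by move=> x y Jx Jy; rewrite scalerBr; apply: JB.
  - by move=> c x Jx; rewrite -numulZr; apply: JM.
move=> a0 [idJ Jn0 Jmin]; split; first exact: scl_ideal.
  move=> J0; apply: Jn0; apply/seteqP; split=> x /=; last first.
    by move=> ->; case: idJ.
  move=> Jx; have: [set y | J (a^-1 *: y)] (a *: x).
    by rewrite /= scalerA mulVf ?scale1r.
  by rewrite J0 /= => /eqP; rewrite scaler_eq0 (negPf a0) => /eqP.
move=> J' idJ' J'J.
have [||E|E] := Jmin [set x | J' (a *: x)].
- exact: scl_ideal.
- by move=> x /= /J'J /=; rewrite scalerA mulVf ?scale1r.
- left; apply/seteqP; split=> x /=; last by move=> ->; case: idJ'.
  move=> J'x; have: [set y | J' (a *: y)] (a^-1 *: x).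
    by rewrite /= scalerA divff ?scale1r.
  by rewrite E /= => /eqP; rewrite scaler_eq0 invr_eq0 (negPf a0) => /eqP.
- right; rewrite -E; apply/seteqP.
  by split=> x /=; rewrite scalerA divff ?scale1r.
Qed.

Lemma socle_closed : subalg_closed socle.
Proof.
split.
- by exists [::]; rewrite ?big_nil.
- move=> x y [s ss ->] [t tt ->]; exists (s ++ t); last by rewrite big_cat.
  by move=> z; rewrite mem_cat => /orP [/ss|/tt].
- move=> a x [s ss ->]; have [->|a0] := eqVneq a 0.
    by exists [::]; rewrite ?big_nil ?scale0r.
  exists [seq a *: y | y <- s]; last by rewrite big_map scaler_sumr.
  move=> _ /mapP [y /ss [J minJ Jy] ->].
  exists [set x | J (a^-1 *: x)]; first exact: minimal_left_idealZ.
  by rewrite /= scalerA mulVf ?scale1r.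
- move=> x _ _ [s ss ->]; exists [seq x ** y | y <- s].
    move=> _ /mapP [y /ss [J minJ Jy] ->]; exists J => //.
    by case: minJ => -[_ _ JM] _ _; apply: JM.
  by rewrite big_map numul_sumr.
Qed.

Definition socle_alg : nuAlgType K := subalg socle_closed.

End Socle.

Arguments socle {K} A.
Arguments socle_alg {K} A.

(* Terms have no constant 1: they present algebras that need not be unital. *)
Inductive term (K X : Type) : Type :=
| tgen of X
| tzero
| topp of term K X
| tadd of term K X & term K X
| tscale of K & term K X
| tmul of term K X & term K X.

Arguments tgen {K X}.
Arguments tzero {K X}.

HB.instance Definition _ (K X : Type) := gen_eqMixin (term K X).
HB.instance Definition _ (K X : Type) := gen_choiceMixin (term K X).

Section Presentation.
Variables (K : fieldType) (X : Type) (R : term K X -> term K X -> Prop).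

(* The least congruence on terms that contains [R] and makes the terms satisfy the
   axioms of an algebra. *)
Inductive congr_rel : term K X -> term K X -> Prop :=
| cr_rel s t : R s t -> congr_rel s t
| cr_refl s : congr_rel s s
| cr_sym s t : congr_rel s t -> congr_rel t s
| cr_trans t s u : congr_rel s t -> congr_rel t u -> congr_rel s u
| cr_opp s s' : congr_rel s s' -> congr_rel (topp s) (topp s')
| cr_add s s' t t' : congr_rel s s' -> congr_rel t t' ->
    congr_rel (tadd s t) (tadd s' t')
| cr_scale a s s' : congr_rel s s' -> congr_rel (tscale a s) (tscale a s')
| cr_mul s s' t t' : congr_rel s s' -> congr_rel t t' ->
    congr_rel (tmul s t) (tmul s' t')
| cr_addA s t u : congr_rel (tadd s (tadd t u)) (tadd (tadd s t) u)
| cr_addC s t : congr_rel (tadd s t) (tadd t s)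
| cr_add0 s : congr_rel (tadd tzero s) s
| cr_addN s : congr_rel (tadd (topp s) s) tzero
| cr_scaleA a b s : congr_rel (tscale a (tscale b s)) (tscale (a * b) s)
| cr_scale1 s : congr_rel (tscale 1 s) s
| cr_scaleDr a s t :
    congr_rel (tscale a (tadd s t)) (tadd (tscale a s) (tscale a t))
| cr_scaleDl a b s :
    congr_rel (tscale (a + b) s) (tadd (tscale a s) (tscale b s))
| cr_mulA s t u : congr_rel (tmul s (tmul t u)) (tmul (tmul s t) u)
| cr_mulDl s t u : congr_rel (tmul (tadd s t) u) (tadd (tmul s u) (tmul t u))
| cr_mulDr s t u : congr_rel (tmul s (tadd t u)) (tadd (tmul s t) (tmul s u))
| cr_mulZl a s t : congr_rel (tmul (tscale a s) t) (tscale a (tmul s t))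
| cr_mulZr a s t : congr_rel (tmul s (tscale a t)) (tscale a (tmul s t)).

Definition congr_relb : rel (term K X) := fun s t => `[< congr_rel s t >].

Lemma congr_relb_refl : reflexive congr_relb.
Proof. by move=> s; apply/asboolP/cr_refl. Qed.

Lemma congr_relb_sym : symmetric congr_relb.
Proof. by move=> s t; apply/asboolP/asboolP => /cr_sym. Qed.

Lemma congr_relb_trans : transitive congr_relb.
Proof.
by move=> t s u /asboolP st /asboolP tu; apply/asboolP/(cr_trans st).
Qed.

Canonical congr_equiv :=
  EquivRel congr_relb congr_relb_refl congr_relb_sym congr_relb_trans.

Definition presented : Type := {eq_quot congr_equiv}%qT.

HB.instance Definition _ := Choice.on presented.

Definition pclass (t : term K X) : presented :=
  (\pi_({eq_quot congr_equiv}) t)%qT.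

Definition prepr (x : presented) : term K X :=
  repr (x : {eq_quot congr_equiv}%qT).

Lemma preprK : cancel prepr pclass.
Proof. exact: reprK. Qed.

Lemma pclassP s t : pclass s = pclass t <-> congr_rel s t.
Proof.
split=> [/eqP|st]; last by apply/eqP; rewrite /pclass eqmodE; apply/asboolP.
by rewrite /pclass eqmodE => /asboolP.
Qed.

Lemma prepr_class t : congr_rel (prepr (pclass t)) t.
Proof. by apply/pclassP; rewrite preprK. Qed.

Definition presented_zero : presented := pclass tzero.
Definition presented_opp (x : presented) : presented := pclass (topp (prepr x)).
Definition presented_add (x y : presented) : presented :=
  pclass (tadd (prepr x) (prepr y)).
Definition presented_scale (a : K) (x : presented) : presented :=
  pclass (tscale a (prepr x)).
Definition presented_mul (x y : presented) : presented :=
  pclass (tmul (prepr x) (prepr y)).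

Lemma presented_oppE s : presented_opp (pclass s) = pclass (topp s).
Proof. by apply/pclassP/cr_opp/prepr_class. Qed.

Lemma presented_addE s t :
  presented_add (pclass s) (pclass t) = pclass (tadd s t).
Proof. by apply/pclassP/cr_add; apply: prepr_class. Qed.

Lemma presented_scaleE a s : presented_scale a (pclass s) = pclass (tscale a s).
Proof. by apply/pclassP/cr_scale/prepr_class. Qed.

Lemma presented_mulE s t :
  presented_mul (pclass s) (pclass t) = pclass (tmul s t).
Proof. by apply/pclassP/cr_mul; apply: prepr_class. Qed.

Lemma presented_addA : associative presented_add.
Proof.
move=> x y z; rewrite -[x]preprK -[y]preprK -[z]preprK !presented_addE.
exact/pclassP/cr_addA.
Qed.

Lemma presented_addC : commutative presented_add.
Proof. move=> x y; exact/pclassP/cr_addC. Qed.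

Lemma presented_add0 : left_id presented_zero presented_add.
Proof.
by move=> x; rewrite -[x]preprK presented_addE; apply/pclassP/cr_add0.
Qed.

Lemma presented_addN : left_inverse presented_zero presented_opp presented_add.
Proof.
by move=> x;
  rewrite -[x]preprK presented_oppE presented_addE; apply/pclassP/cr_addN.
Qed.

HB.instance Definition _ := GRing.isZmodule.Build presented
  presented_addA presented_addC presented_add0 presented_addN.

Lemma presented_scaleA a b x :
  presented_scale a (presented_scale b x) = presented_scale (a * b) x.
Proof. by rewrite -[x]preprK !presented_scaleE; apply/pclassP/cr_scaleA. Qed.

Lemma presented_scale1 : left_id 1 presented_scale.
Proof.
by move=> x; rewrite -[x]preprK presented_scaleE; apply/pclassP/cr_scale1.
Qed.

Lemma pclass0 : pclass tzero = 0.
Proof. by []. Qed.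

Lemma pclassN s : pclass (topp s) = - pclass s.
Proof. by rewrite -presented_oppE. Qed.

Lemma pclassD s t : pclass (tadd s t) = pclass s + pclass t.
Proof. by rewrite -presented_addE. Qed.

Lemma presented_scaleDr : right_distributive presented_scale +%R.
Proof.
move=> a x y; rewrite -[x]preprK -[y]preprK -pclassD !presented_scaleE -pclassD.
exact/pclassP/cr_scaleDr.
Qed.

Lemma presented_scaleDl x : {morph presented_scale^~ x : a b / a + b}.
Proof.
move=> a b; rewrite -[x]preprK !presented_scaleE -pclassD.
exact/pclassP/cr_scaleDl.
Qed.

HB.instance Definition _ := GRing.Zmodule_isLmodule.Build K presented
  presented_scaleA presented_scale1 presented_scaleDr presented_scaleDl.

Lemma pclassZ a s : pclass (tscale a s) = a *: pclass s.
Proof. by rewrite -presented_scaleE. Qed.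

Lemma presented_mulA : associative presented_mul.
Proof.
move=> x y z; rewrite -[x]preprK -[y]preprK -[z]preprK !presented_mulE.
exact/pclassP/cr_mulA.
Qed.

Lemma presented_mulDl : left_distributive presented_mul +%R.
Proof.
move=> x y z; rewrite -[x]preprK -[y]preprK -[z]preprK -pclassD.
by rewrite !presented_mulE -pclassD; apply/pclassP/cr_mulDl.
Qed.

Lemma presented_mulDr : right_distributive presented_mul +%R.
Proof.
move=> x y z; rewrite -[x]preprK -[y]preprK -[z]preprK -pclassD.
by rewrite !presented_mulE -pclassD; apply/pclassP/cr_mulDr.
Qed.

Lemma presented_mulZl (a : K) x y :
  presented_mul (a *: x) y = a *: presented_mul x y.
Proof.
rewrite -[x]preprK -[y]preprK -pclassZ !presented_mulE -pclassZ.
exact/pclassP/cr_mulZl.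
Qed.

Lemma presented_mulZr (a : K) x y :
  presented_mul x (a *: y) = a *: presented_mul x y.
Proof.
rewrite -[x]preprK -[y]preprK -pclassZ !presented_mulE -pclassZ.
exact/pclassP/cr_mulZr.
Qed.

HB.instance Definition _ := Lmodule_isNuAlgebra.Build K presented
  presented_mulA presented_mulDl presented_mulDr
  presented_mulZl presented_mulZr.

Lemma pclassM s t : pclass (tmul s t) = pclass s ** pclass t.
Proof. by rewrite -presented_mulE. Qed.

Definition pgen (x : X) : presented := pclass (tgen x).

End Presentation.

Record graph := Graph {
  vertex : countType;
  edge : countType;
  rng : edge -> vertex;
  src : edge -> vertex }.

Definition out_edges (E : graph) (v : vertex E) : set (edge E) :=
  [set e | src e = v].

Definition regular (E : graph) (v : vertex E) : Prop :=
  finite_set (out_edges v) /\ out_edges v !=set0.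

Inductive lpa_gen (E : graph) : Type :=
| Vertex of vertex E
| Edge of edge E
| Ghost of edge E.

Section LeavittRelations.
Variables (K : fieldType) (E : graph).

Local Notation "'v_ v" := (tgen (Vertex v) : term K (lpa_gen E))
  (at level 8, v at level 2, format "''v_' v").
Local Notation "'e_ e" := (tgen (Edge e) : term K (lpa_gen E))
  (at level 8, e at level 2, format "''e_' e").
Local Notation "'g_ e" := (tgen (Ghost e) : term K (lpa_gen E))
  (at level 8, e at level 2, format "''g_' e").

Inductive lpa_rel : term K (lpa_gen E) -> term K (lpa_gen E) -> Prop :=
| lpa_idem v : lpa_rel (tmul 'v_v 'v_v) 'v_v
| lpa_orth v w : v != w -> lpa_rel (tmul 'v_v 'v_w) tzero
| lpa_src_edge e : lpa_rel (tmul 'v_(src e) 'e_e) 'e_e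
| lpa_edge_rng e : lpa_rel (tmul 'e_e 'v_(rng e)) 'e_e
| lpa_rng_ghost e : lpa_rel (tmul 'v_(rng e) 'g_e) 'g_e
| lpa_ghost_src e : lpa_rel (tmul 'g_e 'v_(src e)) 'g_e
| lpa_CK1 e : lpa_rel (tmul 'g_e 'e_e) 'v_(rng e)
| lpa_CK1_orth e f : e != f -> lpa_rel (tmul 'g_e 'e_f) tzero
| lpa_CK2 v : regular v ->
    lpa_rel 'v_v
      (\big[@tadd K (lpa_gen E)/tzero]_(e <- fset_set (out_edges v))
         tmul 'e_e 'g_e).

End LeavittRelations.

Definition leavitt (K : fieldType) (E : graph) : nuAlgType K :=
  presented (@lpa_rel K E).

(* Main.v *)
(* A minimal left ideal is generated by an element x every nonzero left
   multiple of which generates it again. Right and left multiplication by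
   paths turns x into either a scalar multiple of a vertex or a nonzero
   polynomial in a cycle without exits; the latter is impossible, as such
   polynomials behave like those in K[t, 1/t], which has no minimal ideals. A
   vertex generating a minimal left ideal is a line point: its forward orbit
   has neither bifurcations nor cycles. Hence the socle is the ideal generated
   by the line points. This ideal is spanned by matrix units indexed by the
   paths that meet the line points exactly at their end, two such paths being
   in the same block when their ends are Murray-von Neumann equivalent. *)
From HB Require Import structures.
Require Import Defs.
From mathcomp Require Import all_boot all_order all_algebra.
From mathcomp Require Import finmap boolp classical_sets functions cardinality.

Set Implicit Arguments.
Unset Strict Implicit.
Unset Printing Implicit Defensive.

Import Order.TTheory GRing.Theory.
(* [subalg_closed] is also a name of [ssralg]. *)
Import Defs.

Local Open Scope classical_set_scope.
Local Open Scope ring_scope.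

(** * Spans *)

(** The algebra is given by generators and relations only, so it comes without a basis and
    nonvanishing has to be proved. One representation suffices: on functions graded by an integer, a
    vertex is seen to be independent of the paths of positive length. Every other nonvanishing in
    [leavitt] is reduced to this one by multiplying with paths and ghost paths. Coordinates are
    replaced by induction over [span] and by corners [e x x ** a ** e y y] of matrix units. A vertex
    emitting infinitely many edges has no relation (4). There, an element involves finitely many
    edges only, so some outgoing edge is absent from its ghost part and tests the rest. Murray-von
    Neumann equivalence is preferred to the merging of forward orbits because its transitivity is a
    mere product and because it is exactly what links the ends of two paths. A fixed representative
    of each block and a fixed equivalence to it make the units multiply without correction factors.
    Algebras spanned by matrix units with the same indices and blocks are isomorphic; this gives the
    direct sum and also the matricial stages. *)

Section Span.
Variables (K : fieldType).

(** Adding one generator at a time turns statements about arbitrary elements into inductions that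
    need no independence of [G]. *)
Inductive span (A : lmodType K) (G : set A) : A -> Prop :=
| span0 : span G 0
| spanS (c : K) g x : G g -> span G x -> span G (c *: g + x).

Variable A : lmodType K.
Implicit Types (G H : set A).

Lemma span_gen G g : G g -> span G g.
Proof. by move=> Gg; rewrite -[g]addr0 -[g]scale1r;
  exact: spanS Gg (span0 _). Qed.

Lemma spanD G x y : span G x -> span G y -> span G (x + y).
Proof.
move=> Gx Gy; elim: Gx => [|c g z Gg _ IH]; first by rewrite add0r.
by rewrite -addrA; exact: spanS.
Qed.

Lemma spanZ G c x : span G x -> span G (c *: x).
Proof.
elim=> [|d g z Gg _ IH]; first by rewrite scaler0; exact: span0.
by rewrite scalerDr scalerA; exact: spanS.
Qed.

Lemma spanN G x : span G x -> span G (- x).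
Proof. by rewrite -scaleN1r; exact: spanZ. Qed.

Lemma spanB G x y : span G x -> span G y -> span G (x - y).
Proof. by move=> Gx Gy; apply: spanD => //; exact: spanN. Qed.

Lemma span_sum G (I : Type) (s : seq I) (P : pred I) (F : I -> A) :
  (forall i, P i -> span G (F i)) -> span G (\sum_(i <- s | P i) F i).
Proof.
by move=> GF; apply: big_ind => //; [exact: span0|move=> x y; exact: spanD].
Qed.

Lemma span_sub G H x : (forall g, G g -> span H g) -> span G x -> span H x.
Proof.
move=> GH; elim=> [|c g z Gg _ IH]; first exact: span0.
by apply: spanD => //; apply: spanZ; exact: GH.
Qed.

Lemma span_split G H1 H2 x : (forall g, G g -> H1 g \/ H2 g) ->
  span G x -> exists y z, [/\ span H1 y, span H2 z & x = y + z].
Proof.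
move=> GH; elim=> [|c g z Gg _ [y1 [y2 [Hy1 Hy2 ->]]]].
  by exists 0, 0; split; rewrite ?addr0 //; exact: span0.
case: (GH _ Gg) => Hg.
  by exists (c *: g + y1), y2; split; rewrite ?addrA //; exact: spanS.
exists y1, (c *: g + y2); split=> //; first exact: spanS.
by rewrite addrCA.
Qed.

(** A combination is finite, so the sizes of its generators are bounded. Quantifying over all larger
    [M] lets the bounds of two summands be merged. *)
Lemma span_bound (T : Type) (P : set T) (F : T -> A) (m : T -> nat) x :
  span (F @` P) x ->
  exists N, forall M, (N <= M)%N -> span (F @` [set t | P t /\ (m t <= M)%N]) x.
Proof.
elim=> [|c _ z [t Pt <-] _ [N IH]]; first by exists 0%N => *; exact: span0.
exists (maxn N (m t)) => M; rewrite geq_max => /andP[NM tM].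
by apply: spanS; [exists t|exact: IH].
Qed.

End Span.

Section SpanMap.
Variables (K : fieldType) (A B : lmodType K).
Implicit Types (G H : set A).

Lemma span_linear G (H : set B) (f : A -> B) x : linear f ->
  (forall g, G g -> span H (f g)) -> span G x -> span H (f x).
Proof.
move=> fL Gf; elim=> [|c g z Gg _ IH].
  have := fL (-1) 0 0; rewrite scaler0 add0r scaleN1r addNr => ->.
  exact: span0.
by rewrite fL; apply: spanD => //; apply: spanZ; exact: Gf.
Qed.

End SpanMap.

Section SpanMul.
Variables (K : fieldType) (A : nuAlgType K).
Implicit Types (G H : set A).

Lemma numul_suml (I : Type) (r : seq I) (x : A) (F : I -> A) :
  (\sum_(i <- r) F i) ** x = \sum_(i <- r) F i ** x.
Proof.
by elim: r => [|i r IHr]; rewrite ?big_nil ?numul0r // !big_cons numulDl IHr.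
Qed.

Lemma numulNr (x y : A) : (- x) ** y = - (x ** y).
Proof. by rewrite -scaleN1r numulZl scaleN1r. Qed.

Lemma numulBl (x y z : A) : (x - y) ** z = x ** z - y ** z.
Proof. by rewrite numulDl numulNr. Qed.

Lemma span_mull G H a x : (forall g, G g -> span H (a ** g)) ->
  span G x -> span H (a ** x).
Proof.
move=> GH; elim=> [|c g z Gg _ IH]; first by rewrite numulr0; exact: span0.
by rewrite numulDr numulZr; apply: spanD => //; apply: spanZ; exact: GH.
Qed.

Lemma span_mulr G H a x : (forall g, G g -> span H (g ** a)) ->
  span G x -> span H (x ** a).
Proof.
move=> GH; elim=> [|c g z Gg _ IH]; first by rewrite numul0r; exact: span0.
by rewrite numulDl numulZl; apply: spanD => //; apply: spanZ; exact: GH.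
Qed.

Lemma span_mul G1 G2 H x y :
  (forall g h, G1 g -> G2 h -> span H (g ** h)) ->
  span G1 x -> span G2 y -> span H (x ** y).
Proof.
move=> GH Gx Gy; apply: span_mulr Gx => g Gg.
by apply: span_mull Gy => h Gh; exact: GH.
Qed.

(** The partial sums stay in [S] because the generators do, so a combination in [A] lifts term by
    term. *)
Lemma span_subalg (S : set A) (clS : subalg_closed S) G (x : subalg clS) :
  (forall g, G g -> S g) -> span G (val x) -> span (val @^-1` G) x.
Proof.
move=> GS Gx; move: {-2}(val x) Gx (erefl (val x)) => a Ga.
elim: Ga x => [|c g z Gg _ IH] x xE.
  suff -> : x = 0 by exact: span0.
  by apply: val_inj.
have Sg : g \in subalg_pred clS by apply/mem_set/GS.
have zE : z = val (x - c *: Subalg Sg).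
  have -> : val (x - c *: Subalg Sg) = val x - c *: g by [].
  by rewrite xE [RHS]addrC addKr.
rewrite -[x](subrK (c *: Subalg Sg)) addrC.
by apply: spanS => //; exact: IH.
Qed.

End SpanMul.

(** * Matrix units *)

Section MatrixUnits.
Variables (K : fieldType).

(* [e x y] is only meaningful when [x] and [y] lie in the same block
   [cls x = cls y]. *)
Record mxunits (A : nuAlgType K) (X I : Type) (cls : X -> I)
    (e : X -> X -> A) : Prop := {
  mxunits_mul : forall x y z, cls x = cls y -> cls y = cls z ->
    e x y ** e y z = e x z;
  mxunits_orth : forall x y z w, cls x = cls y -> cls z = cls w -> y <> z ->
    e x y ** e z w = 0;
  mxunits_neq0 : forall x, e x x <> 0 }.

Definition block_units (A : nuAlgType K) (X I : Type) (cls : X -> I)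
    (e : X -> X -> A) : set A :=
  [set a | exists x y, cls x = cls y /\ a = e x y].

Section Theory.
Variables (A : nuAlgType K) (X : choiceType) (I : Type) (cls : X -> I).
Variables (e : X -> X -> A).
Hypothesis mxe : mxunits cls e.
Local Notation S := (span (block_units cls e)).

Lemma mxunits_unit_neq0 x y : cls x = cls y -> e x y <> 0.
Proof.
move=> xy exy; apply: (mxunits_neq0 mxe (x := x)).
by rewrite -(mxunits_mul mxe xy (esym xy)) exy numul0r.
Qed.

Lemma block_units_span x y : cls x = cls y -> S (e x y).
Proof. by move=> xy; apply: span_gen; exists x, y. Qed.

Lemma mxunits_mulE x y z w : cls x = cls y -> cls z = cls w ->
  e x y ** e z w = if y == z then e x w else 0.
Proof.
move=> xy zw; case: eqP => [yz|yz]; last exact: (mxunits_orth mxe).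
by rewrite -yz in zw *; exact: (mxunits_mul mxe).
Qed.

Lemma mxunits_spanM a b : S a -> S b -> S (a ** b).
Proof.
apply: span_mul => _ _ [x [y [xy ->]]] [z [w [zw ->]]].
rewrite mxunits_mulE //; case: eqP => [yz|_]; last exact: span0.
by rewrite -yz in zw; apply: block_units_span; rewrite xy.
Qed.

(** Stated for every larger duplicate-free list, so that the lists found for two summands can be
    joined. *)
Lemma mxunits_local_unit a : S a -> exists s : seq X, forall t,
  uniq t -> {subset s <= t} ->
  (\sum_(x <- t) e x x) ** a = a /\ a ** (\sum_(x <- t) e x x) = a.
Proof.
elim=> [|c _ z [x [y [xy ->]]] _ [s sz]].
  by exists [::] => t _ _; rewrite numul0r numulr0.
exists (x :: y :: s) => t ut st.
have [] := sz t ut; first by move=> u us; apply: st; rewrite !inE us !orbT.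
rewrite numulDl numulDr numulZl numulZr => -> ->.
have xt : x \in t by apply: st; rewrite !inE eqxx.
have yt : y \in t by apply: st; rewrite !inE eqxx orbT.
split; congr (_ *: _ + _).
  rewrite numul_suml (bigD1_seq x) //= (mxunits_mul mxe) // big1 ?addr0 //.
  by move=> u ux; rewrite (mxunits_orth mxe) //; apply/eqP.
rewrite numul_sumr (bigD1_seq y) //= (mxunits_mul mxe) // big1 ?addr0 //.
by move=> u uy; rewrite (mxunits_orth mxe) //; apply/eqP; rewrite eq_sym.
Qed.

(** The scalar [c] plays the role of the matrix entry of [a] at [(x, y)]; entries outside the blocks
    vanish. *)
Lemma mxunits_corner a x y : S a -> exists c,
  e x x ** a ** e y y = c *: e x y /\ (cls x <> cls y -> c = 0).
Proof.
elim=> [|c _ z [u [v [uv ->]]] _ [d [dE d0]]].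
  by exists 0; rewrite numulr0 numul0r scale0r.
(* The summand [c *: e u v] contributes [c] to the entry exactly when [(u, v)] is [(x, y)]. *)
pose b := (x == u) && (v == y).
exists (c *+ b + d); split=> [|xy]; last first.
  rewrite d0 // addr0 /b; case: eqP => //= xu; case: eqP => //= vy.
  by case: xy; rewrite xu uv vy.
rewrite numulDr numulDl {}dE scalerDl; congr (_ + _).
rewrite numulZr numulZl mxunits_mulE // /b.
case: eqP => [->|_] /=; last by rewrite numul0r scaler0 mulr0n scale0r.
rewrite mxunits_mulE //.
by case: eqP => _; rewrite ?mulr1n ?scaler0 ?mulr0n ?scale0r.
Qed.

(** Substitute for linear independence: a local unit on each side cuts [a] into finitely many
    corners, which cannot all vanish. *)
Lemma mxunits_neq0_corner a : S a -> a <> 0 ->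
  exists x y, [/\ cls x = cls y, e x x ** a ** e y y <> 0 &
                  exists2 c, c != 0 & e x x ** a ** e y y = c *: e x y].
Proof.
move=> Sa a0; apply: contrapT => nxy; apply: a0.
have [s sa] := mxunits_local_unit Sa.
have [] := sa (undup s) (undup_uniq s) (fun x => _).
  by move=> x; rewrite mem_undup.
set u := \sum_(x <- _) _ => ua au; rewrite -ua -{1}au numulA.
rewrite /u numul_suml numul_suml big1 // => x _.
rewrite numul_sumr big1 // => y _; apply: contrapT => xay; apply: nxy.
have [c [cE c0]] := mxunits_corner x y Sa; exists x, y; split=> //.
  by apply: contrapT => /c0 cz; apply: xay; rewrite cE cz scale0r.
exists c => //; apply/eqP => cz; apply: xay.
by rewrite cE cz scale0r.
Qed.

End Theory.

Section Iso.
Variables (A B : nuAlgType K) (X : choiceType) (I J : Type).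
Variables (cls : X -> I) (cls' : X -> J) (e : X -> X -> A) (e' : X -> X -> B).
Hypothesis clsE : forall x y, cls x = cls y <-> cls' x = cls' y.
Hypothesis mxe : mxunits cls e.
Hypothesis mxe' : mxunits cls' e'.
Hypothesis genA : forall a, span (block_units cls e) a.
Hypothesis genB : forall b, span (block_units cls' e') b.

(* The graph of the isomorphism. *)
Let G : set (A * B)%type := span [set ab : A * B |
  exists x y, cls x = cls y /\ ab = (e x y, e' x y)].

Let G_total a : exists b, G (a, b).
Proof.
elim: (genA a) => [|c _ z [x [y [xy ->]]] _ [b Gb]].
  by exists 0; exact: span0.
exists (c *: e' x y + b).
by apply: (@spanS _ _ _ c (e x y, e' x y) (z, b)) => //; exists x, y.
Qed.

Let G_surj b : exists a, G (a, b).
Proof.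
elim: (genB b) => [|c _ z [x [y [xy ->]]] _ [a Ga]].
  by exists 0; exact: span0.
exists (c *: e x y + a); apply: (@spanS _ _ _ c (e x y, e' x y) (a, z)) => //.
by exists x, y; split=> //; apply/clsE.
Qed.

(** Related elements have the same entries. Since entries detect zero, [G] relates 0 to 0 only,
    which makes it single-valued in both directions. *)
Let G_corner ab x y : G ab -> exists c,
  e x x ** ab.1 ** e y y = c *: e x y /\ e' x x ** ab.2 ** e' y y = c *: e' x y.
Proof.
elim=> [|c _ z [u [v [uv ->]]] _ [d [dE dE']]].
  by exists 0; rewrite /= !numulr0 !numul0r !scale0r.
pose b := (x == u) && (v == y); exists (c *+ b + d) => /=.
have uv' : cls' u = cls' v by apply/clsE.
rewrite !numulDr !numulDl {}dE {}dE' !scalerDl !numulZr !numulZl.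
rewrite (mxunits_mulE mxe) // (mxunits_mulE mxe') // /b.
case: eqP => [->|_] /=; last by rewrite !numul0r !scaler0 mulr0n !scale0r.
rewrite (mxunits_mulE mxe) // (mxunits_mulE mxe') //.
by case: eqP => _; rewrite ?mulr1n ?scaler0 ?mulr0n ?scale0r.
Qed.

Let G_eq0 ab : G ab -> (ab.1 = 0 <-> ab.2 = 0).
Proof.
move=> Gab; split=> ab0; apply: contrapT.
  move=> /(mxunits_neq0_corner mxe' (genB _)) [x [y [xy xby [d d0 dE]]]].
  have [c [cE cE']] := G_corner x y Gab; move: cE.
  rewrite ab0 numulr0 numul0r => /esym/eqP; rewrite scaler_eq0 => /orP[] /eqP.
    by move=> c0; apply: xby; rewrite cE' c0 scale0r.
  by apply: (mxunits_unit_neq0 mxe); apply/clsE.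
move=> /(mxunits_neq0_corner mxe (genA _)) [x [y [xy xby [d d0 dE]]]].
have [c [cE cE']] := G_corner x y Gab; move: cE'.
rewrite ab0 numulr0 numul0r => /esym/eqP; rewrite scaler_eq0 => /orP[] /eqP.
  by move=> c0; apply: xby; rewrite cE c0 scale0r.
by apply: (mxunits_unit_neq0 mxe'); apply/clsE.
Qed.

Let G_inj a b b' : G (a, b) -> G (a, b') -> b = b'.
Proof.
move=> Gb Gb'; apply/eqP; rewrite -subr_eq0; apply/eqP.
by have := G_eq0 (spanB Gb Gb'); rewrite /= subrr => -[-> //].
Qed.

Let G_inj' a a' b : G (a, b) -> G (a', b) -> a = a'.
Proof.
move=> Ga Ga'; apply/eqP; rewrite -subr_eq0; apply/eqP.
by have := G_eq0 (spanB Ga Ga'); rewrite /= subrr => -[_ -> //].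
Qed.

Let G_mul ab ab' : G ab -> G ab' -> G (ab.1 ** ab'.1, ab.2 ** ab'.2).
Proof.
elim=> [|c _ z [x [y [xy ->]]] _ IH] Gab' /=.
  by rewrite !numul0r; exact: span0.
rewrite !numulDl !numulZl.
suff H : G (e x y ** ab'.1, e' x y ** ab'.2).
  exact: (spanD (spanZ c H) (IH Gab')).
elim: Gab' => [|d _ w [u [v [uv ->]]] _ IH'] /=.
  by rewrite !numulr0; exact: span0.
rewrite !numulDr !numulZr.
suff H : G (e x y ** e u v, e' x y ** e' u v).
  exact: (spanD (spanZ d H) IH').
have xy' : cls' x = cls' y by apply/clsE.
have uv' : cls' u = cls' v by apply/clsE.
rewrite (mxunits_mulE mxe) // (mxunits_mulE mxe') //.
case: eqP => [yu|_]; last exact: span0.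
by apply: span_gen; exists x, v; split=> //; rewrite xy yu.
Qed.

Lemma mxunits_isom : nualg_isom A B.
Proof.
have [f Gf] := choice G_total; have [g Gg] := choice G_surj.
exists f; split; last first.
  exists g => [a|b]; first exact: G_inj' (Gg _) (Gf _).
  exact: G_inj (Gf _) (Gg _).
split=> [c a b|a b].
  by apply: G_inj (Gf _) _; exact: (spanD (spanZ c (Gf a)) (Gf b)).
by apply: G_inj (Gf _) _; exact: (G_mul (Gf a) (Gf b)).
Qed.

End Iso.

Lemma mxunits_comp (A : nuAlgType K) (X Y I J : Type) (cls : X -> I)
    (cls' : Y -> J) (e : X -> X -> A) (g : Y -> X) :
  injective g -> (forall y z, cls' y = cls' z <-> cls (g y) = cls (g z)) ->
  mxunits cls e -> mxunits cls' (fun y z => e (g y) (g z)).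
Proof.
move=> gI gE [mul orth neq0]; split=> [x y z /gE xy /gE yz|x y z w|x].
- exact: mul.
- by move=> /gE xy /gE zw yz; apply: orth => // /gI.
- exact: neq0.
Qed.

Lemma block_units_comp (A : nuAlgType K) (X Y I J : Type) (cls : X -> I)
    (cls' : Y -> J) (e : X -> X -> A) (g : Y -> X) :
  (forall x, exists y, g y = x) ->
  (forall y z, cls' y = cls' z <-> cls (g y) = cls (g z)) ->
  block_units cls' (fun y z => e (g y) (g z)) = block_units cls e.
Proof.
move=> gS gE; apply/seteqP; split=> a [x [y [xy ->]]].
  by exists (g x), (g y); split=> //; apply/gE.
have [u ux] := gS x; have [v vy] := gS y.
by exists u, v; split; [apply/gE; rewrite ux vy|rewrite ux vy].
Qed.

End MatrixUnits.

Arguments infmx_entry : simpl never.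

(** * Standard matrix units of [matalg] and of direct sums *)

Section StandardUnits.
Variables (K : fieldType).

Lemma delta_mxunits (n : nat) :
  mxunits (A := 'M[K]_n) (fun=> tt) (@delta_mx K n n).
Proof.
split=> [i j k _ _|i j k l _ _ jk|i].
- exact: mul_delta_mx.
- by apply: mul_delta_mx_0; apply/eqP.
- move=> /matrixP /(_ i i) /eqP; rewrite !mxE eqxx /= mulr1n.
  exact/negP/oner_neq0.
Qed.

Lemma span_delta_mx (n : nat) (a : 'M[K]_n) :
  span (block_units (A := 'M[K]_n) (fun=> tt) (@delta_mx K n n)) a.
Proof.
rewrite [a]matrix_sum_delta.
apply: span_sum => i _; apply: span_sum => j _; apply: spanZ.
exact: block_units_span.
Qed.

Definition infmx_delta_fun (i j : nat) : nat -> nat -> K^o :=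
  fun k l => if (k == i) && (l == j) then 1 else 0.

Lemma infmx_delta_subproof i j : infmx_delta_fun i j \in @finite_entries K.
Proof.
apply/finite_entriesP; exists (maxn i j).+1 => k l; rewrite /infmx_delta_fun.
case: eqP => [->|//]; case: eqP => [->|//] /=.
by rewrite !gtn_max !ltnn /= andbF.
Qed.

Definition infmx_delta i j : infmx K := Infmx (infmx_delta_subproof i j).

Lemma infmx_deltaE i j k l :
  infmx_entry (infmx_delta i j) k l = ((k == i) && (l == j))%:R.
Proof. by rewrite /infmx_entry /= /infmx_delta_fun; case: ifP. Qed.

Lemma infmx_delta_mul i j k l :
  infmx_delta i j ** infmx_delta k l =
  if j == k then infmx_delta i l else 0.
Proof.
apply: infmxP => a b; rewrite (@infmx_mulE _ _ _ j.+1); last first.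
  by move=> c jc; rewrite infmx_deltaE [c == j]gtn_eqF // andbF.
rewrite (bigD1 ord_max) //= big1 ?addr0 => [|c cj]; last first.
  have /negPf cj' : val c != j by exact: cj.
  by rewrite infmx_deltaE cj' andbF mul0r.
rewrite !infmx_deltaE eqxx andbT.
case: (j == k); last by rewrite mulr0.
by rewrite infmx_deltaE; case: (a == i); rewrite ?mul1r ?mul0r.
Qed.

Lemma infmx_delta_mxunits : mxunits (fun=> tt) infmx_delta.
Proof.
split=> [i j k _ _|i j k l _ _ /eqP/negPf jk|i]; rewrite ?infmx_delta_mul.
- by rewrite eqxx.
- by rewrite jk.
- move=> /(congr1 (fun x => infmx_entry x i i)).
  by rewrite infmx_deltaE eqxx; apply/eqP/oner_neq0.
Qed.

Lemma span_infmx_delta (a : infmx K) :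
  span (block_units (fun=> tt) infmx_delta) a.
Proof.
have [N aN] := infmx_bound a.
have sumE (s : seq nat) (F : nat -> infmx K) k l :
    infmx_entry (\sum_(i <- s) F i) k l = \sum_(i <- s) infmx_entry (F i) k l.
  by elim: s => [|i s IH]; rewrite ?big_nil // !big_cons infmxDE IH.
suff -> : a = \sum_(i <- iota 0 N) \sum_(j <- iota 0 N)
                 infmx_entry a i j *: infmx_delta i j.
  apply: span_sum => i _; apply: span_sum => j _; apply: spanZ.
  exact: block_units_span.
apply: infmxP => k l; rewrite sumE.
under eq_bigr do rewrite sumE.
have [kN|Nk] := ltnP k N; last first.
  rewrite aN ?Nk // big_seq big1 // => i; rewrite mem_iota add0n => /andP[_ iN].
  rewrite big1 // => j _.
  by rewrite infmxZE infmx_deltaE gtn_eqF ?mulr0 // (leq_trans iN).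
rewrite (bigD1_seq k) ?iota_uniq ?mem_iota //= [X in _ + X]big1 ?addr0;
  last first.
  move=> i ik; rewrite big1 // => j _.
  by rewrite infmxZE infmx_deltaE eq_sym (negPf ik) mulr0.
have [lN|Nl] := ltnP l N; last first.
  rewrite aN ?Nl ?orbT // big_seq big1 // => j;
    rewrite mem_iota add0n => /andP[_ jN].
  by rewrite infmxZE infmx_deltaE [l == j]gtn_eqF ?andbF ?mulr0 // (leq_trans
    jN).
rewrite (bigD1_seq l) ?iota_uniq ?mem_iota //= [X in _ + X]big1 ?addr0;
  last first.
  move=> j jl.
  by rewrite infmxZE infmx_deltaE [l == j]eq_sym (negPf jl) andbF mulr0.
by rewrite infmxZE infmx_deltaE !eqxx mulr1.
Qed.

Definition mxindex (n : option nat) :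
  choiceType := if n is Some m then 'I_m else nat.

Definition matalg_delta (n : option nat) :
  mxindex n -> mxindex n -> matalg K n :=
  match n with Some m => @delta_mx K m m | None => infmx_delta end.

Lemma matalg_delta_mxunits n : mxunits (fun=> tt) (@matalg_delta n).
Proof.
by case: n => [n|]; [exact: delta_mxunits|exact: infmx_delta_mxunits].
Qed.

Lemma span_matalg_delta n a : span (block_units (fun=> tt) (@matalg_delta n)) a.
Proof.
by case: n a => [n|] a; [exact: (@span_delta_mx n a)|exact: span_infmx_delta].
Qed.

End StandardUnits.

Section DirectSumUnits.
Variables (K : fieldType) (I : choiceType) (A : I -> nuAlgType K).

Definition dirprod_inj i (a : A i) : dirprod A := fun j =>
  if pselect (i = j) is left ij then eq_rect i (fun k =>
    A k : Type) a j ij else 0.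

Lemma dirprod_injE i a : @dirprod_inj i a i = a.
Proof. by rewrite /dirprod_inj; case: pselect => // ii; rewrite eq_axiomK. Qed.

Lemma dirprod_inj_neq i (a : A i) j : i <> j -> dirprod_inj a j = 0.
Proof. by rewrite /dirprod_inj; case: pselect. Qed.

Lemma dirprodDE (f g : dirprod A) i : (f + g) i = f i + g i.
Proof. by []. Qed.

Lemma dirprodZE c (f : dirprod A) i : (c *: f) i = c *: f i.
Proof. by []. Qed.

Lemma dirprodME (f g : dirprod A) i : (f ** g) i = f i ** g i.
Proof. by []. Qed.

Lemma dirprod_inj_linear i : linear (@dirprod_inj i).
Proof.
move=> c a b; apply: functional_extensionality_dep => j.
rewrite dirprodDE dirprodZE.
have [<-|ij] := pselect (i = j); first by rewrite !dirprod_injE.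
by rewrite !dirprod_inj_neq // scaler0 addr0.
Qed.

Lemma dirprod_inj_mul i (a b : A i) :
  dirprod_inj a ** dirprod_inj b = dirprod_inj (a ** b).
Proof.
apply: functional_extensionality_dep => j; rewrite dirprodME.
have [<-|ij] := pselect (i = j); first by rewrite !dirprod_injE.
by rewrite !dirprod_inj_neq // numul0r.
Qed.

Lemma dirprod_inj_mul0 i j (a : A i) (b : A j) : i <> j ->
  dirprod_inj a ** dirprod_inj b = 0.
Proof.
move=> ij; apply: functional_extensionality_dep => k; rewrite dirprodME.
have [<-|ik] := pselect (i = k).
  by rewrite [X in _ ** X]dirprod_inj_neq ?numulr0 // => /esym.
by rewrite [X in X ** _]dirprod_inj_neq ?numul0r.
Qed.

Lemma dirprod_inj_supp i (a : A i) : fin_supp (dirprod_inj a).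
Proof.
apply: sub_finite_set (finite_set1 i) => j /= aj.
by apply: contrapT => ij; apply: aj; rewrite dirprod_inj_neq // => /esym.
Qed.

Definition dirsum_inj i (a : A i) : dirsum A :=
  @Subalg _ _ _ (fin_supp_closed A) _ (mem_set (dirprod_inj_supp a)).

Lemma dirsum_inj_linear i : linear (@dirsum_inj i).
Proof. by move=> c a b; apply: val_inj; exact: dirprod_inj_linear. Qed.

Lemma dirsum_inj_mul i (a b : A i) :
  dirsum_inj a ** dirsum_inj b = dirsum_inj (a ** b).
Proof. by apply: val_inj; exact: (dirprod_inj_mul a b). Qed.

Lemma dirsum_inj_mul0 i j (a : A i) (b : A j) : i <> j ->
  dirsum_inj a ** dirsum_inj b = 0.
Proof. by move=> ij; apply: val_inj; exact: (dirprod_inj_mul0 a b ij). Qed.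

Lemma dirsum_inj0 i : dirsum_inj (0 : A i) = 0.
Proof.
apply: val_inj; apply: functional_extensionality_dep => j.
have [<-|ij] := pselect (i = j); first exact: dirprod_injE.
exact: dirprod_inj_neq.
Qed.

Variables (Y : I -> choiceType) (E : forall i, Y i -> Y i -> A i).
Hypothesis mxE : forall i, mxunits (fun=> tt) (@E i).
Hypothesis genE : forall i a, span (block_units (fun=> tt) (@E i)) a.

(** [tagged_as] reads the index of [v] in the block of [u]. For different blocks it returns a
    default, which is harmless because units are only used inside a block. *)
Definition dirsum_units (u v : {i & Y i}) : dirsum A :=
  dirsum_inj (E (tagged u) (tagged_as u v)).

Lemma dirsum_mxunits : mxunits (fun u : {i & Y i} => tag u) dirsum_units.
Proof.
split=> [[i x] [j y] [k z] /= ij jk|[i x] [j y] [k z] [l w] /= ij kl|[i x]].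
- case: _ / ij y jk => y jk; case: _ / jk z => z.
  by rewrite /dirsum_units !tagged_asE dirsum_inj_mul (mxunits_mul (mxE i)).
- case: _ / ij y => y; case: _ / kl w => w yz.
  have [ik|ik] := pselect (i = k); last exact: dirsum_inj_mul0.
  case: _ / ik z w yz => z w yz; rewrite /dirsum_units !tagged_asE.
  rewrite dirsum_inj_mul (mxunits_orth (mxE i)) ?dirsum_inj0 // => yz'.
  by apply: yz; rewrite yz'.
- rewrite /dirsum_units /= tagged_asE => /(congr1 (fun f : dirsum A =>
  (val f : dirprod A) i)) /=.
  by rewrite dirprod_injE; exact: mxunits_neq0.
Qed.

Lemma span_dirsum_units a :
  span (block_units (fun u : {i & Y i} => tag u) dirsum_units) a.
Proof.
have inj_span i (b : A i) :
    span (block_units (fun u : {i & Y i} => tag u) dirsum_units) (dirsum_inj b).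
  apply: span_linear (genE b); first exact: dirsum_inj_linear.
  move=> _ [x [y [_ ->]]]; apply: span_gen.
  by exists (Tagged Y x), (Tagged Y y); rewrite /dirsum_units /= tagged_asE.
have /finite_seqP[s as_] : fin_supp (val a) by apply/set_mem; case: a.
suff -> : a = \sum_(i <- undup s) dirsum_inj (val a i) by apply: span_sum.
have sumE (r : seq I) (F : I -> dirsum A) i :
    val (\sum_(j <- r) F j) i = \sum_(j <- r) val (F j) i.
  by elim: r => [|j r IH]; rewrite ?big_nil // !big_cons -IH.
apply: val_inj; apply: functional_extensionality_dep => i; rewrite sumE.
have [ai|ai] := pselect (val a i = 0).
  rewrite big1_seq // => j _; rewrite /=.
  have [ji|ji] := pselect (j = i); last by rewrite dirprod_inj_neq.
  by rewrite ji dirprod_injE.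
have si : i \in s by have : [set` s] i by rewrite -as_.
rewrite (bigD1_seq i) ?mem_undup ?undup_uniq //= dirprod_injE big1 ?addr0 //.
by move=> j /eqP ji; rewrite dirprod_inj_neq.
Qed.

End DirectSumUnits.

Section Classification.
Variables (K : fieldType) (A : nuAlgType K) (X I' : choiceType) (J : Type).
Variables (cls : X -> J) (e : X -> X -> A).
Hypothesis mxe : mxunits cls e.
Hypothesis gene : forall a, span (block_units cls e) a.

(** The enumerations [g i] of the blocks together reindex [X] by pairs of a block and a position,
    which are the indices of the standard units of the direct sum. *)
Lemma mxunits_dirsum (n : I' -> option nat) (g : forall i, mxindex (n i) -> X) :
  (forall i, injective (g i)) ->
  (forall i j k l, cls (g i k) = cls (g j l) -> i = j) ->
  (forall i k l, cls (g i k) = cls (g i l)) ->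
  (forall x, exists i k, g i k = x) ->
  nualg_isom A (dirsum (fun i => matalg K (n i))).
Proof.
move=> g_inj g_cls g_clsE g_surj.
pose Y := {i & mxindex (n i)}.
pose h (u : Y) : X := g (tag u) (tagged u).
have h_cls (u v : Y) : tag u = tag v <-> cls (h u) = cls (h v).
  split; last by move=> /g_cls.
  by case: u v => i k [j l] /= ij; case: _ / ij l => l; exact: g_clsE.
have h_inj : injective h.
  move=> u v uv; have /h_cls := congr1 cls uv.
  case: u v uv => i k [j l] /= + ij; case: _ / ij l => l.
  by move=> /g_inj /= ->.
have h_surj x : exists u, h u = x.
  by have [i [k <-]] := g_surj x; exists (Tagged (fun j => mxindex (n j)) k).
apply: (@mxunits_isom _ _ _ Y _ _ (fun u => tag u) (fun u => tag u)
  (fun u v => e (h u) (h v)) (dirsum_units (fun i => @matalg_delta K (n i)))).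
- by [].
- exact: mxunits_comp h_inj h_cls mxe.
- by apply: dirsum_mxunits => i; exact: matalg_delta_mxunits.
- by move=> a; rewrite (block_units_comp _ h_surj h_cls).
- by apply: span_dirsum_units => i; exact: span_matalg_delta.
Qed.

End Classification.

(** * Subalgebras and directed unions *)

Section Subalgebras.
Variables (K : fieldType) (A : nuAlgType K) (S : set A).
Hypothesis clS : subalg_closed S.

(* Junk value [0] outside [S]. *)
Definition to_subalg (a : A) : subalg clS :=
  if pselect (S a) is left Sa then Subalg (mem_set Sa) else 0.

Lemma to_subalgK a : S a -> val (to_subalg a) = a.
Proof. by rewrite /to_subalg; case: pselect. Qed.

Lemma subalgP (x : subalg clS) : S (val x).
Proof. by apply/set_mem; case: x. Qed.

Lemma subalg_valK (x : subalg clS) : to_subalg (val x) = x.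
Proof. by apply: val_inj; rewrite to_subalgK //; exact: subalgP. Qed.

Variables (X J : Type) (cls : X -> J) (e : X -> X -> A).

Lemma subalg_mxunits : (forall x y, cls x = cls y -> S (e x y)) ->
  mxunits cls e -> mxunits cls (fun x y => to_subalg (e x y)).
Proof.
move=> Se [mul orth neq0].
split=> [x y z xy yz|x y z w xy zw yz|x].
- apply: val_inj; rewrite [LHS]/(_ ** _) !to_subalgK; [|apply: Se;
  congruence..].
  exact: mul.
- apply: val_inj; rewrite [LHS]/(_ ** _) !to_subalgK; [|apply: Se;
  congruence..].
  exact: orth.
- by move=> /(congr1 val); rewrite to_subalgK; [exact: neq0|exact: Se].
Qed.

Lemma span_subalg_units : (forall x y, cls x = cls y -> S (e x y)) ->
  (forall a, S a -> span (block_units cls e) a) ->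
  forall a, span (block_units cls (fun x y => to_subalg (e x y))) a.
Proof.
move=> Se Sspan a.
have : span (val @^-1` block_units cls e) a.
  apply: span_subalg; last exact/Sspan/subalgP.
  by move=> _ [x [y [xy ->]]]; exact: Se.
apply: span_sub => b [x [y [xy bE]]]; apply: span_gen; exists x, y; split=> //.
by rewrite -bE subalg_valK.
Qed.

End Subalgebras.

Section DirectedUnion.
Variables (K : fieldType) (d : Order.disp_t) (D : porderType d) (L :
  nuAlgType K).
Variables (S : D -> set L).
Hypothesis clS : forall i, subalg_closed (S i).
Hypothesis S_mono : forall i j, (i <= j)%O -> S i `<=` S j.
Hypothesis S_cover : forall x, exists i, S i x.
Hypothesis D_dir : directed D.

Definition subalg_incl i j (_ : (i <= j)%O) (x : subalg (clS i)) :
  subalg (clS j) :=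
  to_subalg (clS j) (val x).

Lemma subalg_inclE i j (ij : (i <= j)%O) x : val (subalg_incl ij x) = val x.
Proof. by rewrite to_subalgK //; apply: S_mono ij _ _; exact: subalgP. Qed.

Lemma directed_union_system : direct_system subalg_incl.
Proof.
split=> [i j ij|i ii x|i j k ij jk ik x].
- split=> [c x y|x y]; apply: val_inj.
    by rewrite subalg_inclE -[RHS]/(c *: val (subalg_incl ij x) +
      val (subalg_incl ij y)) !subalg_inclE.
  by rewrite subalg_inclE -[RHS]/(val (subalg_incl ij x) **
      val (subalg_incl ij y)) !subalg_inclE.
- by apply: val_inj; rewrite subalg_inclE.
- by apply: val_inj; rewrite !subalg_inclE.
Qed.

(** The mediating map evaluates [f] at some stage containing the element; a common upper stage shows
    that the choice of stage does not matter. *)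
Lemma directed_union_limit :
  is_direct_limit subalg_incl (fun i (x : subalg (clS i)) => val x).
Proof.
split; first by split=> [i|i j ij x]; [split|exact: subalg_inclE].
move=> B f [f_hom f_incl].
have [i Si] := choice S_cover.
pose h x := f (i x) (to_subalg (clS (i x)) x).
have hE j x : S j x -> h x = f j (to_subalg (clS j) x).
  move=> Sjx; have [k [ik jk]] := D_dir.2 (i x) j.
  rewrite /h -(f_incl _ _ ik) -(f_incl _ _ jk); congr (f k _); apply: val_inj.
  by rewrite !subalg_inclE !to_subalgK.
have common x y : exists k, S k x /\ S k y.
  have [k [xk yk]] := D_dir.2 (i x) (i y); exists k.
  by split; [exact: S_mono xk _ (Si x)|exact: S_mono yk _ (Si y)].
exists h; split=> [|h' [_ h'E]]; last first.
  by apply/funext => x; rewrite /h -h'E to_subalgK.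
split=> [|j x]; last by rewrite (hE j) ?subalg_valK //; exact: subalgP.
split=> [c x y|x y]; have [k [kx ky]] := common x y;
  have [S0 SD SZ SM] := clS k.
  rewrite !(hE k) //; last by apply: SD => //; exact: SZ.
  rewrite -(f_hom k).1; congr (f k _); apply: val_inj.
  rewrite -[RHS]/(c *: val (to_subalg (clS k) x) + val (to_subalg (clS k) y)).
  by rewrite !to_subalgK //; apply: SD => //; exact: SZ.
rewrite !(hE k) //; last exact: SM.
rewrite -(f_hom k).2; congr (f k _); apply: val_inj.
rewrite -[RHS]/(val (to_subalg (clS k) x) ** val (to_subalg (clS k) y)).
by rewrite !to_subalgK //; exact: SM.
Qed.

End DirectedUnion.

(** * Algebras spanned by countably many matrix units *)

Section Enumeration.

Lemma set_enum (X : countType) (P : set X) :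
  exists (n : option nat) (g : mxindex n -> X), injective g /\ range g = P.
Proof.
have [|infP] := pselect (finite_set P).
  move=> /finite_seqP[s ->]; exists (Some (size (undup s))).
  case: s => [|x s].
    (* The empty list offers no default element for [nth], and [X] itself may be empty. *)
    exists (fun i : 'I_0 => False_rect X (notF (ltn_ord i))).
    split=> [[]//|]; apply/seteqP; split=> x //=; first by case=> -[].
  set t := undup (x :: s).
  exists (fun i : 'I_(size t) => nth x t i); split=> [i j|].
    by move=> /eqP; rewrite nth_uniq ?undup_uniq // => /eqP /val_inj.
  apply/seteqP; split=> y /=; first by case=> i _ <-;
    rewrite -mem_undup mem_nth.
  rewrite -mem_undup -/t => yt.
  have yi : (index y t < size t)%N by rewrite index_mem.
  by exists (Ordinal yi) => //=; rewrite nth_index.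
have /card_set_bijP[f [_ f_inj f_surj]] := eq_card_nat (countableP P) infP.
have /choice[g gP] : forall n, exists x, P x /\ f x = n.
  by move=> n; have [x Px fx] := f_surj n I; exists x.
exists None, g; split=> [i j ij|].
  by rewrite -(gP i).2 -(gP j).2 ij.
apply/seteqP; split=> x; first by case=> i _ <-; exact: (gP i).1.
move=> Px; exists (f x) => //; apply: f_inj; rewrite ?inE //;
  first exact: (gP _).1.
exact: (gP _).2.
Qed.

End Enumeration.

Section MatrixUnitAlgebras.
Variables (K : fieldType).

Lemma nualg_isom_trans (A B C : nuAlgType K) :
  nualg_isom A B -> nualg_isom B C -> nualg_isom A C.
Proof.
move=> [f [[fL fM] fB]] [g [[gL gM] gB]]; exists (g \o f).
split; last exact: bij_comp.
by split=> [c x y|x y] /=; rewrite ?fL ?gL ?fM ?gM.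
Qed.

Lemma dirsum_finite (I : finType) (A : I -> nuAlgType K) :
  nualg_isom (dirsum A) (dirprod A).
Proof.
exists val; split; first by split.
have fin f : fin_supp (f : dirprod A) by exact: finite_finset.
exists (fun f => to_subalg (fin_supp_closed A) f) => [x|f].
  exact: subalg_valK.
exact: to_subalgK.
Qed.

Lemma mxunits_matricial (A : nuAlgType K) (X J : choiceType) (cls : X -> J)
    (e : X -> X -> A) (s : seq X) (x0 : X) :
  mxunits cls e -> (forall a, span (block_units cls e) a) ->
  (forall x, x \in s) -> matricial A.
Proof.
move=> mxe gene sP.
pose C := undup (map cls s).
have CP x : cls x \in C by rewrite mem_undup map_f.
have C_gt0 : (0 < size C)%N by rewrite lt0n size_eq0;
  apply: contraTneq (CP x0) => ->.
(* [matricial] wants a successor as number of factors and as size of each; [x0] makes [C] nonempty,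
   and each class in [C] is attained. *)
pose P (i : 'I_(size C).-1.+1) := [seq x <- undup s | cls x == nth (cls x0) C
  i].
have iC (i : 'I_(size C).-1.+1) :
  (i < size C)%N by rewrite -[X in (_ < X)%N]prednK.
have P_gt0 i : (0 < size (P i))%N.
  have : nth (cls x0) C i \in map cls s by rewrite -mem_undup mem_nth.
  move=> /mapP[x xs xE]; suff : x \in P i by case: (P i).
  by rewrite mem_filter xE eqxx mem_undup.
pose n i := (size (P i)).-1.
have nS i : (n i).+1 = size (P i) by rewrite prednK.
have kP i (k : 'I_(n i).+1) : (k < size (P i))%N.
  by rewrite -nS.
pose g i (k : 'I_(n i).+1) := nth x0 (P i) k.
have gP i k : cls (g i k) = nth (cls x0) C i.
  by have := mem_nth x0 (kP i k); rewrite mem_filter => /andP[/eqP].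
exists (size C).-1, n.
apply: (nualg_isom_trans (B := dirsum (fun i => matalg K (Some (n i).+1))));
  last first.
  exact: (dirsum_finite (fun i => matalg K (Some (n i).+1))).
apply: (mxunits_dirsum mxe gene (n := fun i => Some (n i).+1) (g := g)).
- move=> i k l /eqP; rewrite nth_uniq ?filter_uniq ?undup_uniq //.
  by move=> /eqP /val_inj.
- move=> i j k l; rewrite !gP => /eqP; rewrite nth_uniq ?undup_uniq //.
  by move=> /eqP /val_inj.
- by move=> i k l; rewrite !gP.
- move=> x; have xC : (index (cls x) C < (size C).-1.+1)%N.
    by rewrite prednK // index_mem.
  have xP : x \in P (Ordinal xC).
    by rewrite mem_filter /= nth_index // eqxx mem_undup sP.
  have xn : (index x (P (Ordinal xC)) < (n (Ordinal xC)).+1)%N.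
    by rewrite nS index_mem.
  by exists (Ordinal xC), (Ordinal xn); rewrite /g /= nth_index.
Qed.

Variables (A : nuAlgType K) (X J : countType) (cls : X -> J) (e : X -> X -> A).
Hypothesis mxe : mxunits cls e.
Hypothesis gene : forall a, span (block_units cls e) a.

Lemma mxunits_classification : exists (I : countType) (n : I -> option nat),
  (forall i, n i <> Some 0%N) /\
  nualg_isom A (dirsum (fun i => matalg K (n i))).
Proof.
(* Keeping only the classes that are attained excludes blocks of size 0. *)
pose I := {i : J | `[< exists x, cls x = i >]}.
have /choice[n /(_ _)/cid] : forall i : I, exists (n : option nat),
    exists g : mxindex n -> X, injective g /\ range g = [set x | cls x = val i].
  by move=> i; exact: set_enum.
move=> gP; pose g i := projT1 (gP i).
have g_inj i : injective (g i) by exact: (projT2 (gP i)).1.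
have g_range i : range (g i) = [set x | cls x = val i] by exact:
  (projT2 (gP i)).2.
have g_cls i k : cls (g i k) = val i.
  by have : range (g i) (g i k) by []; rewrite g_range.
exists I, n; split=> [i ni|].
  have /asboolP[x xi] := valP i.
  have : range (g i) x by rewrite g_range.
  by move: (g i); rewrite ni => gi [[]].
apply: (mxunits_dirsum mxe gene (g := g)) => //.
- by move=> i j k l; rewrite !g_cls => /val_inj.
- by move=> i k l; rewrite !g_cls.
- move=> x; have xI : `[< exists y, cls y = cls x >] by apply/asboolP; exists x.
  pose i : I := exist _ (cls x) xI; have : range (g i) x by rewrite g_range.
  by case=> k _ <-; exists i, k.
Qed.

Lemma mxunits_locally_matricial (x0 : X) : locally_matricial A.
Proof.
(* Stage [k] uses the finitely many indices of bounded code. The offset [pickle x0] puts [x0] into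
   every stage, so that no stage is the zero algebra. *)
pose P k (x : X) := (choice.pickle x <= choice.pickle x0 + k)%N.
pose eP k (u v : {x | P k x}) := e (val u) (val v).
pose clsP k (u : {x | P k x}) := cls (val u).
have mxP k : mxunits (@clsP k) (@eP k) by exact: mxunits_comp val_inj _ mxe.
pose S k := span (block_units (@clsP k) (@eP k)).
have clS k : subalg_closed (S k).
  split; first exact: span0.
  - by move=> x y; exact: spanD.
  - by move=> a x; exact: spanZ.
  - by move=> x y; exact: (mxunits_spanM (mxP k)).
have Sgen k x y : P k x -> P k y -> cls x = cls y -> S k (e x y).
  move=> xk yk xy.
  by apply: span_gen; exists (exist _ x xk), (exist _ y yk).
have S_mono i j : (i <= j)%O -> S i `<=` S j.
  move=> ij a; apply: span_sub => _ [[x xi] [[y yi] [/= xy ->]]].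
  by apply: Sgen => //; apply: leq_trans;
    [exact: xi|rewrite leq_add2l|exact: yi|rewrite leq_add2l].
have D_dir : directed nat.
  split; first by exists 0%N.
  by move=> i j; exists (maxn i j); split; [exact: leq_maxl|exact: leq_maxr].
have S_cover a : exists k, S k a.
  elim: (gene a) => [|c _ z [x [y [xy ->]]] _ [k Skz]]; first by exists 0%N;
    exact: span0.
  exists (maxn k (maxn (choice.pickle x) (choice.pickle y))).
  apply: spanD; last by apply: S_mono Skz; exact: leq_maxl.
  apply: spanZ; apply: Sgen => //; rewrite /P;
    apply: leq_trans (leq_addl _ _); rewrite !leq_max leqnn ?orbT //.
exists _, nat, (fun k => subalg (clS k)), (@subalg_incl _ _ _ _ _ clS),
  (fun i x => val x).
split=> //.
- move=> k.
  have Seq x y : clsP k x = clsP k y -> S k (eP k x y).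
    by move=> xy; apply: span_gen; exists x, y.
  have x0P : P k x0 by exact: leq_addr.
  pose xs : seq {x | P k x} :=
    pmap insub (pmap choice.unpickle (iota 0 (choice.pickle x0 + k).+1)).
  have xsP u : u \in xs.
    rewrite mem_pmap -valK map_f // mem_pmap -choice.pickleK map_f // mem_iota
      add0n.
    exact: (valP u).
  have mxk := subalg_mxunits (clS k) Seq (mxP k).
  have genk := @span_subalg_units _ _ _ (clS k) _ _ _ _ Seq (fun a Sa => Sa).
  exact: mxunits_matricial (exist _ x0 x0P) mxk genk xsP.
- exact: directed_union_system.
- exact: directed_union_limit.
Qed.

End MatrixUnitAlgebras.

(** * Paths in Leavitt path algebras *)

Section Paths.
Variable E : graph.
Implicit Types (v w : vertex E) (e f : edge E) (p q : seq (edge E)).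

Fixpoint is_path v p : bool :=
  if p is e :: q then (src e == v) && is_path (rng e) q else true.

Fixpoint target v p : vertex E := if p is e :: q then target (rng e) q else v.

Lemma target_cat v p q : target v (p ++ q) = target (target v p) q.
Proof. by elim: p v => //= e p IH v. Qed.

Lemma is_path_cat v p q : is_path v (p ++ q) = is_path v p && is_path (target v
  p) q.
Proof. by elim: p v => //= e p IH v; rewrite IH andbA. Qed.

(** These are the three outcomes of a ghost path meeting a path with the same source: a path
    remains, a ghost path remains, or two different edges meet and the product is 0. *)
Lemma path_compare p q :
  [\/ exists r, q = p ++ r, exists2 r, r <> [::] & p = q ++ r |
      exists s e f p' q', [/\ p = s ++ e :: p', q = s ++ f :: q' & e <> f]].
Proof.
elim: p q => [|e p IH] [|f q].
- by constructor 1; exists [::].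
- by constructor 1; exists (f :: q).
- by constructor 2; exists (e :: p).
have [<-|ef] := eqVneq e f; last first.
  by constructor 3; exists [::], e, f, p, q; split=> //; apply/eqP.
have [[r ->]|[r r0 ->]|[s [e' [f' [p' [q' [-> -> ef]]]]]]] := IH q.
- by constructor 1; exists r.
- by constructor 2; exists r.
- by constructor 3; exists (e :: s), e', f', p', q'.
Qed.

End Paths.

Section Leavitt.
Variables (K : fieldType) (E : graph).
Implicit Types (v w : vertex E) (e f : edge E) (p q : seq (edge E)).
Local Notation L := (leavitt K E).

Definition lvertex v : L := pgen (@lpa_rel K E) (Vertex v).
Definition ledge e : L := pgen (@lpa_rel K E) (Edge e).
Definition lghost e : L := pgen (@lpa_rel K E) (Ghost e).

Let rel_eq s t : @lpa_rel K E s t -> pclass (@lpa_rel K E) s = pclass (@lpa_rel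
  K E) t.
Proof. by move=> st; apply/pclassP/cr_rel. Qed.

Lemma lvertexE v w : lvertex v ** lvertex w = if v == w then lvertex v else 0.
Proof.
rewrite /lvertex /pgen -pclassM; case: eqP => [->|/eqP vw].
  exact/rel_eq/lpa_idem.
exact/rel_eq/lpa_orth.
Qed.

Lemma lvertex_idem v : lvertex v ** lvertex v = lvertex v.
Proof. by rewrite lvertexE eqxx. Qed.

Lemma src_ledge e : lvertex (src e) ** ledge e = ledge e.
Proof. by rewrite /lvertex /ledge /pgen -pclassM;
  exact/rel_eq/lpa_src_edge. Qed.

Lemma ledge_rng e : ledge e ** lvertex (rng e) = ledge e.
Proof. by rewrite /lvertex /ledge /pgen -pclassM;
  exact/rel_eq/lpa_edge_rng. Qed.

Lemma rng_lghost e : lvertex (rng e) ** lghost e = lghost e.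
Proof. by rewrite /lvertex /lghost /pgen -pclassM;
  exact/rel_eq/lpa_rng_ghost. Qed.

Lemma lghost_src e : lghost e ** lvertex (src e) = lghost e.
Proof. by rewrite /lvertex /lghost /pgen -pclassM;
  exact/rel_eq/lpa_ghost_src. Qed.

Lemma lghost_ledge e f : lghost e ** ledge f = if e == f then lvertex (rng e)
  else 0.
Proof.
rewrite /ledge /lghost /pgen -pclassM; case: eqP => [->|/eqP ef].
  exact/rel_eq/lpa_CK1.
exact/rel_eq/lpa_CK1_orth.
Qed.

Lemma lvertex_CK2 v : regular v ->
  lvertex v = \sum_(e <- fset_set (out_edges v)) ledge e ** lghost e.
Proof.
move=> rv; rewrite /lvertex /pgen (rel_eq (lpa_CK2 K rv)).
elim: (fset_set _ : seq _) => [|e s IH]; rewrite ?big_nil // !big_cons.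
by rewrite pclassD pclassM IH.
Qed.

Lemma lvertex_CK2_single e : (forall f, src f = src e -> f = e) ->
  lvertex (src e) = ledge e ** lghost e.
Proof.
move=> fe; have outE : out_edges (src e) = [set e].
  by apply/seteqP; split=> f; [exact: fe|move=> ->].
rewrite lvertex_CK2; last first.
  by split; [rewrite outE; exact: finite_set1|exists e].
by rewrite outE fset_set1 big_seq_fset1.
Qed.

(** The start [v] is a parameter because an empty list of edges does not determine it. A nonempty
    list ignores it, hence the [is_path] hypotheses below. *)
Fixpoint lpath v p : L := if p is e ::
  q then ledge e ** lpath (rng e) q else lvertex v.
Fixpoint gpath v p : L := if p is e ::
  q then gpath (rng e) q ** lghost e else lvertex v.

Lemma lpath_src v p : is_path v p -> lvertex v ** lpath v p = lpath v p.
Proof.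
case: p => [_|e p] /=; first exact: lvertex_idem.
by case/andP=> /eqP <- _; rewrite numulA src_ledge.
Qed.

Lemma gpath_src v p : is_path v p -> gpath v p ** lvertex v = gpath v p.
Proof.
case: p => [_|e p] /=; first exact: lvertex_idem.
by case/andP=> /eqP <- _; rewrite -numulA lghost_src.
Qed.

Lemma lpath_tgt v p : lpath v p ** lvertex (target v p) = lpath v p.
Proof.
elim: p v => [|e p IH] v /=; first exact: lvertex_idem.
by rewrite -numulA IH.
Qed.

Lemma gpath_tgt v p : lvertex (target v p) ** gpath v p = gpath v p.
Proof.
elim: p v => [|e p IH] v /=; first exact: lvertex_idem.
by rewrite numulA IH.
Qed.

Lemma lpath_cat v p q : is_path v (p ++ q) ->
  lpath v (p ++ q) = lpath v p ** lpath (target v p) q.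
Proof.
elim: p v => [|e p IH] v /=; first by move=> vq; rewrite lpath_src.
by case/andP=> _ /IH ->; rewrite numulA.
Qed.

Lemma gpath_cat v p q : is_path v (p ++ q) ->
  gpath v (p ++ q) = gpath (target v p) q ** gpath v p.
Proof.
elim: p v => [|e p IH] v /=; first by move=> vq; rewrite gpath_src.
by case/andP=> _ /IH ->; rewrite numulA.
Qed.

Lemma gpath_lpath v p : is_path v p -> gpath v p ** lpath v p = lvertex (target
  v p).
Proof.
elim: p v => [|e p IH] v /=; first by rewrite lvertex_idem.
case/andP=> _ pp; rewrite -numulA [_ ** (_ ** lpath _ _)]numulA lghost_ledge
  eqxx.
by rewrite lpath_src // IH.
Qed.

Lemma gpath_lpath_cat v p q : is_path v (p ++ q) ->
  gpath v p ** lpath v (p ++ q) = lpath (target v p) q.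
Proof.
move=> vpq; move: (vpq); rewrite is_path_cat => /andP[vp pq].
by rewrite lpath_cat // numulA gpath_lpath // lpath_src.
Qed.

Lemma gpath_cat_lpath v p q : is_path v (p ++ q) ->
  gpath v (p ++ q) ** lpath v p = gpath (target v p) q.
Proof.
move=> vpq; move: (vpq); rewrite is_path_cat => /andP[vp pq].
by rewrite gpath_cat // -numulA gpath_lpath // gpath_src.
Qed.

Lemma gpath_lpath_neq v s e f p q : e <> f ->
  is_path v (s ++ e :: p) -> is_path v (s ++ f :: q) ->
  gpath v (s ++ e :: p) ** lpath v (s ++ f :: q) = 0.
Proof.
move=> /eqP/negPf ef vp vq; rewrite gpath_cat // -numulA gpath_lpath_cat /=;
  last first.
  by [].
by rewrite -numulA [_ ** (ledge f ** _)]numulA lghost_ledge ef numul0r numulr0.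
Qed.

Lemma lvertex_lpath w v p : is_path v p ->
  lvertex w ** lpath v p = if w == v then lpath v p else 0.
Proof.
move=> vp; rewrite -{1}lpath_src // numulA lvertexE.
by case: eqP => [->|_]; rewrite ?lpath_src ?numul0r.
Qed.

Lemma gpath_lvertex w v p : is_path v p ->
  gpath v p ** lvertex w = if w == v then gpath v p else 0.
Proof.
move=> vp; rewrite -{1}gpath_src // -numulA lvertexE eq_sym.
by case: eqP => _; rewrite ?gpath_src ?numulr0.
Qed.

Lemma gpath_lpath0 v w p q : is_path v p -> is_path w q -> v <> w ->
  gpath v p ** lpath w q = 0.
Proof.
move=> vp wq /eqP/negPf vw.
by rewrite -gpath_src // -numulA lvertex_lpath // vw numulr0.
Qed.

Definition monomial v p w q : L := lpath v p ** gpath w q.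

Definition monomials : set L := [set x | exists v p w q,
  [/\ is_path v p, is_path w q, target v p = target w q & x = monomial v p w
    q]].

Lemma monomial_mul x y : monomials x -> monomials y -> span monomials (x ** y).
Proof.
move=> [v [p [w [q [vp wq pq ->]]]]] [v' [p' [w' [q' [vp' wq' pq' ->]]]]].
rewrite /monomial -numulA [gpath w q ** _]numulA.
have [wv|wv] := eqVneq w v'; last first.
  by rewrite gpath_lpath0 ?numul0r ?numulr0 //; [exact: span0|exact/eqP].
subst v'; have [[r rE]|[r _ rE]|[s [e [f [p1 [q1 [pE qE ef]]]]]]] :=
  path_compare q p'.
- subst p'; rewrite gpath_lpath_cat // -pq numulA.
  move: vp'; rewrite is_path_cat => /andP[_ vr].
  rewrite -lpath_cat ?is_path_cat ?vp ?pq //.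
  apply: span_gen; exists v, (p ++ r), w', q'; split=> //.
    by rewrite is_path_cat vp pq.
  by rewrite target_cat pq -target_cat.
- subst q; rewrite gpath_cat_lpath // pq'.
  move: wq; rewrite is_path_cat => /andP[_ vr].
  rewrite -gpath_cat ?is_path_cat ?wq' -?pq' //.
  apply: span_gen; exists v, p, w', (q' ++ r); split=> //.
    by rewrite is_path_cat wq' -pq'.
  by rewrite target_cat -pq' -target_cat.
- subst q p'; rewrite gpath_lpath_neq // numul0r numulr0; exact: span0.
Qed.

Lemma span_monomials x : span monomials x.
Proof.
rewrite -[x]preprK; elim: (prepr x) =>
  {x} [[v|e|e]| |t IH|s IHs t IHt|a t IH|s IHs t IHt].
- apply: span_gen; exists v, [::], v, [::]; split=> //.
  exact/esym/lvertex_idem.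
- apply: span_gen; exists (src e), [:: e], (rng e), [::]; split=> //=;
  first by rewrite eqxx.
  by rewrite /monomial /= -!numulA lvertex_idem ledge_rng.
- apply: span_gen; exists (rng e), [::], (src e), [:: e]; split=> //=;
  first by rewrite eqxx.
  by rewrite /monomial /= numulA lvertex_idem rng_lghost.
- exact: span0.
- by rewrite pclassN; exact: spanN.
- by rewrite pclassD; exact: spanD.
- by rewrite pclassZ; exact: spanZ.
- by rewrite pclassM; exact: span_mul monomial_mul IHs IHt.
Qed.

(** The algebra has no unit when there are infinitely many vertices; this puts [x] back into the
    left ideal of its multiples. *)
Lemma local_unit (x : L) : exists u : L, u ** x = x.
Proof.
suff [s sP] : exists s : seq (vertex E), forall t, uniq t -> {subset s <= t} ->
    (\sum_(v <- t) lvertex v) ** x = x.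
  exists (\sum_(v <- undup s) lvertex v).
  by apply: (sP _ (undup_uniq s)) => v; rewrite mem_undup.
elim: (span_monomials x) => [|c _ z [v [p [w [q [vp wq pq ->]]]]] _ [s sz]].
  by exists [::] => *; rewrite numulr0.
exists (v :: s) => t ut st; rewrite numulDr numulZr sz //; last first.
  by move=> u us; apply: st; rewrite inE us orbT.
congr (_ *: _ + _); rewrite /monomial numulA; congr (_ ** _).
have vt : v \in t by apply: st; rewrite inE eqxx.
rewrite numul_suml (bigD1_seq v) //= lpath_src // big1 ?addr0 // => u /negPf uv.
by rewrite lvertex_lpath // uv.
Qed.

Lemma lvertex_neq0_right (x : L) : x <> 0 -> exists v, x ** lvertex v <> 0.
Proof.
move=> x0; apply: contrapT => nv; apply: x0.
suff [s sP] : exists s : seq (vertex E), forall t, uniq t -> {subset s <= t} ->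
    x ** (\sum_(v <- t) lvertex v) = x.
  rewrite -(sP (undup s)) ?undup_uniq //; last by move=> v; rewrite mem_undup.
  rewrite numul_sumr big1 // => v _; apply: contrapT => xv.
  by apply: nv; exists v.
elim: (span_monomials x) => [|c _ z [v [p [w [q [vp wq pq ->]]]]] _ [s sz]].
  by exists [::] => *; rewrite numul0r.
exists (w :: s) => t ut st; rewrite numulDl numulZl sz //; last first.
  by move=> u us; apply: st; rewrite inE us orbT.
congr (_ *: _ + _); rewrite /monomial -numulA; congr (_ ** _).
have wt : w \in t by apply: st; rewrite inE eqxx.
rewrite numul_sumr (bigD1_seq w) //= gpath_src // big1 ?addr0 // => u /negPf uw.
by rewrite gpath_lvertex // uw.
Qed.

Lemma lvertex_neq0_left (x : L) : x <> 0 -> exists v, lvertex v ** x <> 0.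
Proof.
move=> x0; apply: contrapT => nv; apply: x0; have [u <-] := local_unit x.
have ux y : span monomials y -> y ** x = 0.
  elim=> [|c _ z [v [p [w [q [vp wq pq ->]]]]] _ IH]; first by rewrite numul0r.
  rewrite numulDl IH addr0 numulZl /monomial -gpath_src // -!numulA.
  have -> : lvertex w ** x = 0 by apply: contrapT => wx; apply: nv; exists w.
  by rewrite !numulr0 scaler0.
exact/ux/span_monomials.
Qed.

End Leavitt.

(** * A representation on a branching system *)

Section Branching.
Variable E : graph.

(** Each vertex carries a copy of [nat], and the edges leaving it embed the copies at their ranges
    as disjoint pieces, with partial inverse [psi]. At a regular vertex the pieces must cover
    everything, as relation (4) demands. *)
Lemma branching_system : exists (phi : edge E -> nat -> nat)
    (psi : vertex E -> nat -> option (edge E * nat)),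
  [/\ forall e k, psi (src e) (phi e k) = Some (e, k),
      forall v j e k, psi v j = Some (e, k) -> src e = v /\ phi e k = j &
      forall v j, regular v -> psi v j <> None].
Proof.
pose s (v : vertex E) : seq (edge E) := fset_set (out_edges v).
have sE v e : regular v -> (e \in s v) = (src e == v).
  by case=> fv _; rewrite /s in_fset_set //;
    apply/idP/eqP => [/set_mem//|/mem_set].
(* At a regular vertex the remainder modulo the number of outgoing edges names the edge and the
   quotient is [k]. Elsewhere nothing has to be covered, and any injective code of [(e, k)] will
   do. *)
pose phi (e : edge E) k := if pselect (regular (src e)) is left _
  then (k * size (s (src e)) + index e (s (src e)))%N else choice.pickle (e, k).
pose psi v j := if pselect (regular v) is left _
  then omap (fun e => (e, j %/ size (s v))%N) (onth (s v) (j %% size (s v)))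
  else if choice.pickle_inv j is Some (e, k)
       then if src e == v then Some (e, k : nat) else None else None.
have onthS e (t : seq (edge E)) n :
  (n < size t)%N -> onth t n = Some (nth e t n).
  by move=> nt; rewrite onthE (nth_map e).
exists phi, psi; split=> [e k|v j e k|v j rv]; rewrite /phi /psi.
- case: pselect => [re|_]; last by rewrite choice.pickleK_inv eqxx.
  have es : e \in s (src e) by rewrite sE.
  have ei : (index e (s (src e)) < size (s (src e)))%N by rewrite index_mem.
  have s0 : (0 < size (s (src e)))%N by apply: leq_trans ei.
  rewrite modnMDl modn_small // divnMDl // divn_small // addn0.
  by rewrite (onthS e) // nth_index.
- case: pselect => [rv|nrv]; last first.
    case jE: (choice.pickle_inv j) => [[e' k']|//]; case: eqP => // e'v [<- <-].
    split=> //; rewrite e'v; case: pselect => // _.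
    by have := @choice.pickle_invK (edge E * nat)%type j; rewrite jE.
  case jE: (onth _ _) => [e'|] //= [e'e <-]; subst e'.
  have s0 : (0 < size (s v))%N.
    by rewrite lt0n size_eq0; apply: contra_eq_neq jE => ->; rewrite onth0n.
  have js : (j %% size (s v) < size (s v))%N by rewrite ltn_pmod.
  move: jE; rewrite (onthS e) // => -[eE].
  have ev : src e = v by apply/eqP; rewrite -sE // -eE mem_nth.
  split=> //; rewrite ev; case: pselect => // _.
  have us : uniq (s v) by exact: fset_uniq.
  by rewrite -eE index_uniq // -divn_eq.
- case: pselect => // _; have [fv [e /= ev]] := rv.
  have es : e \in s v by rewrite sE // ev.
  have s0 : (0 < size (s v))%N by apply: leq_trans (_ : index e (s v) < _)%N;
    rewrite ?index_mem.
  by rewrite (onthS e) // ltn_pmod.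
Qed.

End Branching.

Section PresentedAction.
Variables (K : fieldType) (X : Type) (R : term K X -> term K X -> Prop).
Variables (W : lmodType K) (gact : X -> W -> W).
Hypothesis gactP : forall x a h h',
  gact x (a *: h + h') = a *: gact x h + gact x h'.

Fixpoint act (t : term K X) (h : W) : W :=
  match t with
  | tgen x => gact x h
  | tzero => 0
  | topp s => - act s h
  | tadd s t => act s h + act t h
  | tscale a s => a *: act s h
  | tmul s t => act s (act t h)
  end.

Lemma actP t a h h' : act t (a *: h + h') = a *: act t h + act t h'.
Proof.
elim: t h h' => [x| |s IH|s IHs t IHt|b s IH|s IHs t IHt] h h' /=.
- exact: gactP.
- by rewrite scaler0 addr0.
- by rewrite IH opprD scalerN.
- by rewrite IHs IHt scalerDr addrACA.
- by rewrite IH scalerDr !scalerA mulrC.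
- by rewrite IHt IHs.
Qed.

Lemma actD t h h' : act t (h + h') = act t h + act t h'.
Proof. by rewrite -[h]scale1r actP !scale1r. Qed.

Lemma act0 t : act t 0 = 0.
Proof.
by have := actP t (-1) 0 0; rewrite scaler0 add0r scaleN1r addNr.
Qed.

Lemma actZ t a h : act t (a *: h) = a *: act t h.
Proof. by rewrite -[a *: h]addr0 actP act0 addr0. Qed.

Hypothesis act_rel : forall s t h, R s t -> act s h = act t h.

(** Linear operators satisfy the algebra axioms by themselves, so checking the relations [R] is
    enough for the presented algebra to act. *)
Lemma act_congr s t : congr_rel R s t -> forall h,
  act s h = act t h.
Proof.
elim=> {s t} /=.
- by move=> s t st h; exact: act_rel.
- by [].
- by move=> s t _ IH h; rewrite IH.
- by move=> s t u _ IH _ IH' h; rewrite IH.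
- by move=> s t _ IH h; rewrite IH.
- by move=> s s' t t' _ IH _ IH' h; rewrite IH IH'.
- by move=> a s t _ IH h; rewrite IH.
- by move=> s s' t t' _ IH _ IH' h; rewrite IH IH'.
- by move=> *; rewrite addrA.
- by move=> *; rewrite addrC.
- by move=> *; rewrite add0r.
- by move=> *; rewrite addNr.
- by move=> *; rewrite scalerA.
- by move=> *; rewrite scale1r.
- by move=> *; rewrite scalerDr.
- by move=> *; rewrite scalerDl.
- by [].
- by [].
- by move=> *; rewrite actD.
- by [].
- by move=> *; rewrite actZ.
Qed.

Definition presented_act (x : presented R) : W -> W := act (prepr x).

Lemma presented_act_class t h : presented_act (pclass R t) h = act t h.
Proof. exact/act_congr/prepr_class. Qed.

Lemma presented_act0 h : presented_act 0 h = 0.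
Proof. by rewrite -pclass0 presented_act_class. Qed.

Lemma presented_actP a x y h :
  presented_act (a *: x + y) h = a *: presented_act x h + presented_act y h.
Proof.
rewrite -[x in LHS]preprK -[y in LHS]preprK -pclassZ -pclassD.
exact: presented_act_class.
Qed.

Lemma presented_actM x y h :
  presented_act (x ** y) h = presented_act x (presented_act y h).
Proof.
rewrite -[x in LHS]preprK -[y in LHS]preprK -pclassM.
exact: presented_act_class.
Qed.

End PresentedAction.

Definition positive_paths (K : fieldType) (E : graph) : set (leavitt K E) :=
  [set x | exists v p, [/\ is_path v p, p <> [::] & x = lpath K v p]].
Arguments positive_paths {K E}.

Section Representation.
Variables (K : fieldType) (E : graph).
Variables (phi : edge E -> nat -> nat).
Variables (psi : vertex E -> nat -> option (edge E * nat)).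
Hypothesis psi_phi : forall e k, psi (src e) (phi e k) = Some (e, k).
Hypothesis phi_psi : forall v j e k,
  psi v j = Some (e, k) -> src e = v /\ phi e k = j.
Hypothesis psi_regular : forall v j, regular v -> psi v j <> None.

(* The integer coordinate records the length of paths, so that powers of a cycle
   act independently. *)
Let W : lmodType K := vertex E -> int -> nat -> K^o.

(** An edge carries functions at its range to its piece of the copy at its source and raises the
    integer by 1; its ghost restricts to that piece and carries back. *)
Definition gen_act (g : lpa_gen E) (h : W) : W :=
  match g with
  | Vertex v => fun u n j => if u == v then h u n j else 0
  | Edge e => fun u n j => if psi u j is Some (f, k)
      then if f == e then h (rng e) (n - 1) k else 0 else 0
  | Ghost e => fun u n j =>
      if u == rng e then h (src e) (n + 1) (phi e j) else 0
  end.

Let WD (x y : W) u n j : (x + y) u n j = x u n j + y u n j.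
Proof. by []. Qed.

Let WZ a (x : W) u n j : (a *: x) u n j = a * x u n j.
Proof. by []. Qed.

Lemma gen_actP g a h h' :
  gen_act g (a *: h + h') = a *: gen_act g h + gen_act g h'.
Proof.
apply/funext => u; apply/funext => n; apply/funext => j.
rewrite WD WZ; case: g => [v|e|e]; rewrite /gen_act.
- by case: ifP => _; rewrite ?WD ?WZ ?mulr0 ?addr0.
- case: (psi u j) => [[f k]|]; last by rewrite mulr0 addr0.
  by case: ifP => _; rewrite ?WD ?WZ ?mulr0 ?addr0.
- by case: ifP => _; rewrite ?WD ?WZ ?mulr0 ?addr0.
Qed.

Lemma act_rel s t h : @lpa_rel K E s t -> act gen_act s h = act gen_act t h.
Proof.
case=> [v|v w /negPf vw|e|e|e|e|e|e f /negPf ef|v rv];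
  apply/funext => u; apply/funext => n; apply/funext => j /=.
- by case: ifP => [->|].
- by case: eqP => // ->; rewrite vw.
- case uj: (psi u j) => [[f k]|]; last by case: ifP.
  case: (eqVneq f e) => [fe|_]; last by case: ifP.
  by have [<- _] := phi_psi uj; rewrite fe eqxx.
- by case: (psi u j) => [[f k]|//]; case: ifP => // _; rewrite eqxx.
- by case: ifP => [->|].
- by rewrite eqxx.
- by case: eqP => // ->; rewrite psi_phi eqxx addrK.
- by case: ifP => // _; rewrite psi_phi ef.
- have sumE (r : seq (edge E)) :
    act gen_act (\big[@tadd K (lpa_gen E)/tzero]_(e <- r)
         tmul (tgen (Edge e)) (tgen (Ghost e))) h u n j =
    \sum_(e <- r) act gen_act (tmul (tgen (Edge e)) (tgen (Ghost e))) h u n j.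
    by elim: r => [|e r IH]; rewrite ?big_nil // !big_cons -IH.
  rewrite sumE; have [fv _] := rv; case: eqP => [uv|uv].
    subst u; case vj: (psi v j) (@psi_regular v j rv) => [[e k]|] // _.
    have [ev phij] := phi_psi vj.
    rewrite (bigD1_seq e) ?fset_uniq //=; last by rewrite in_fset_set //;
      apply/mem_set.
    rewrite vj !eqxx ev phij subrK big1 ?addr0 // => f fe.
    by rewrite eq_sym (negPf fe).
  rewrite big_seq big1 // => e; rewrite in_fset_set // => /set_mem ev /=.
  case uj: (psi u j) => [[f k]|//]; case: eqP => // fe.
  by have [fu _] := phi_psi uj; case: uv; rewrite -fu fe ev.
Qed.

Local Notation lact := (presented_act (R := @lpa_rel K E) gen_act).

Let lact_class t h : lact (pclass (@lpa_rel K E) t) h = act gen_act t h.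
Proof. by apply: presented_act_class; [exact: gen_actP|exact: act_rel]. Qed.

Let lactM x y h : lact (x ** y) h = lact x (lact y h).
Proof. by apply: presented_actM; [exact: gen_actP|exact: act_rel]. Qed.

Let lactPE a x y h u n j :
  lact (a *: x + y) h u n j = a * lact x h u n j + lact y h u n j.
Proof.
rewrite presented_actP ?WD ?WZ //; [exact: gen_actP|exact: act_rel].
Qed.

Let lact0 h u n j : lact 0 h u n j = 0.
Proof. by rewrite presented_act0 //; [exact: gen_actP|exact: act_rel]. Qed.

Definition homogeneous (d : int) (h : W) := forall v n j, n != d -> h v n j = 0.

Lemma lpath_act v p d h : homogeneous d h -> homogeneous (d + (size p)%:Z)
  (lact (lpath K v p) h).
Proof.
elim: p v => [|e p IH] v hd /=.
  rewrite addr0 => u n j nd; rewrite lact_class /=; case: ifP => // _;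
    exact: hd.
move=> u n j nd; rewrite lactM lact_class /=; case: (psi u j) => [[f k]|//].
case: ifP => // _; apply: IH => //; apply: contra nd => /eqP nE.
by rewrite -[n](subrK 1) nE -addrA; apply/eqP; congr (_ + _);
  rewrite -PoszD addn1.
Qed.

(** Applied to a function concentrated in degree 0, a path of positive length lands in positive
    degree. The value in degree 0 at [u] therefore sees the coefficient [a] alone. *)
Lemma act_lvertex_positive (u : vertex E) a (y : leavitt K E) :
  span positive_paths y ->
  a *: lvertex K u + y = 0 -> a = 0.
Proof.
move=> y_pos ay.
pose h0 : W := fun _ n _ => if n == 0 then 1 else 0.
have h0P : homogeneous 0 h0 by move=> v n j /negPf n0; rewrite /h0 n0.
have y0 v j : lact y h0 v 0 j = 0.
  elim: y_pos => [|c _ z [w [p [_ p0 ->]]] _ IH]; first by rewrite lact0.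
  rewrite lactPE IH addr0 (lpath_act w h0P) ?mulr0 //.
  by case: p p0.
have : lact (a *: lvertex K u + y) h0 u 0 0%N = 0 by rewrite ay lact0.
by rewrite lactPE y0 addr0 lact_class /= eqxx /h0 eqxx mulr1.
Qed.

End Representation.

(** The source of all nonvanishing statements about the Leavitt path algebra below. *)
Lemma lvertex_positive (K : fieldType) (E : graph) (u : vertex E) (a : K) y :
  span positive_paths y -> a *: lvertex K u + y = 0 -> a = 0.
Proof.
have [phi [psi [psi_phi phi_psi psi_reg]]] := branching_system E.
exact: act_lvertex_positive psi_phi phi_psi psi_reg _ _ _.
Qed.

Lemma lvertex_neq0 (K : fieldType) (E : graph) (u : vertex E) :
  lvertex K u <> 0.
Proof.
move=> u0; have /eqP := oner_neq0 K; apply.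
by apply: (@lvertex_positive K E u 1 0 (span0 _)); rewrite u0 scaler0 addr0.
Qed.

(** * Reduction to polynomials in closed paths *)

Section Reduction.
Variables (K : fieldType) (E : graph).
Implicit Types (v w : vertex E) (e f : edge E) (p q : seq (edge E)).
Local Notation L := (leavitt K E).
Local Notation lvertex := (lvertex K).
Local Notation ledge := (ledge K).
Local Notation lghost := (lghost K).
Local Notation lpath := (lpath K).
Local Notation gpath := (gpath K).

Definition lpaths u v : set L :=
  lpath u @` [set p | is_path u p /\ target u p = v].

(** The empty path is left out: in [c *: lvertex v + z] it is the constant term, and [z] consists of
    positive paths. *)
Definition closed_paths v : set L :=
  lpath v @` [set p | [/\ is_path v p, target v p = v & p <> [::]]].

Lemma closed_positive v y : span (closed_paths v) y -> span positive_paths y.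
Proof.
by apply: span_sub => _ [p [vp _ p0] <-]; apply: span_gen; exists v, p.
Qed.

Lemma closed_lvertex v y : span (closed_paths v) y ->
  lvertex v ** y = y /\ y ** lvertex v = y.
Proof.
elim=> [|c _ z [p [vp pv p0] <-] _ [IHl IHr]]; first by rewrite numul0r numulr0.
rewrite numulDr numulDl IHl IHr numulZl numulZr lpath_src //.
by rewrite -[in X in _ ** lvertex X]pv lpath_tgt.
Qed.

Lemma span_single (A : lmodType K) (P : Prop) (g x : A) :
  span [set y | P /\ y = g] x -> exists c, x = c *: g /\ (c <> 0 -> P).
Proof.
elim=> [|c _ z [Pg ->] _ [d [-> _]]]; first by exists 0; rewrite scale0r.
by exists (c + d); rewrite scalerDl.
Qed.

(** A substitute for relation (4) valid at every vertex: summing over the first edges that occur in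
    [y] recovers [y]. *)
Lemma positive_expand y : span positive_paths y ->
  exists2 s : seq (edge E), uniq s & y = \sum_(e <- s) ledge e ** (lghost e **
    y).
Proof.
move=> yP; suff [s sP] : exists s :
  seq (edge E), forall t, uniq t -> {subset s <= t} ->
    \sum_(e <- t) ledge e ** (lghost e ** y) = y.
  exists (undup s); rewrite ?undup_uniq // sP ?undup_uniq // => e.
  by rewrite mem_undup.
elim: yP => [|c _ z [v [[|e p] [//= vp _ ->]]] _ [s sz]].
  by exists [::] => t _ _; rewrite big1 // => e _; rewrite !numulr0.
exists (e :: s) => t ut st.
have et : e \in t by apply: st; rewrite inE eqxx.
under eq_bigr do rewrite numulDr numulZr numulDr numulZr.
rewrite big_split sz /=; last first.
  - by move=> f fs; apply: st; rewrite inE fs orbT.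
  - by [].
congr (_ + _); rewrite -scaler_sumr; congr (_ *: _).
rewrite (bigD1_seq e) //= [lghost e ** _]numulA lghost_ledge eqxx.
case/andP: vp => _ vp; rewrite lpath_src // big1 ?addr0 // => f /negPf fe.
by rewrite [lghost f ** _]numulA lghost_ledge fe numul0r numulr0.
Qed.

Lemma lghost_lpaths N e u v y :
  span (lpath u @` [set p | [/\ is_path u p, target u p = v,
    p <> [::] & (size p < N.+1)%N]]) y ->
  span (lpath (rng e) @` [set p | [/\ is_path (rng e) p,
    target (rng e) p = v & (size p < N)%N]])
    (lghost e ** y).
Proof.
apply: span_mull => _ [[|f p] [//= /andP[_ fp] pv _ pN] <-] /=.
rewrite numulA lghost_ledge; case: eqP => [->|_]; last by rewrite numul0r;
  exact: span0.
by rewrite lpath_src //; apply: span_gen; exists p.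
Qed.

(** As long as no trivial path occurs in [y], [positive_expand] gives a ghost edge not annihilating
    [y], and multiplying by it shortens all paths. The induction on their maximal length stops at a
    nonzero constant term. *)
Lemma lpaths_reduction u v y : span (lpaths u v) y -> y <> 0 ->
  exists q c z, [/\ is_path u q, target u q = v, c <> 0,
    span (closed_paths v) z &
    gpath u q ** y = c *: lvertex v + z].
Proof.
move=> /(span_bound size)[N /(_ N (leqnn _))] yN.
have {yN} : span (lpath u @` [set p | [/\ is_path u p,
  target u p = v & (size p < N.+1)%N]]) y.
  by apply: span_sub yN => _ [p [[up pv] pN] <-]; apply: span_gen; exists p.
elim: {N}N.+1 u y => [|N IH] u y yN y0.
  case: y0; elim: yN => // c _ z [p [_ _]] //.
have [|y1 [y2 [/span_single[c [-> cP]] y2P yE]]] :=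
    span_split (H1 := [set x | u = v /\ x = lvertex u])
    (H2 := lpath u @` [set p | [/\ is_path u p, target u p = v, p <> [::] &
       (size p < N.+1)%N]]) _ yN.
  move=> _ [[|e p] [up pv pN] <-]; first by left.
  by right; exists (e :: p).
have [c0|c0] := pselect (c = 0); last first.
  have uv := cP c0; subst v; exists [::], c, y2; split=> //.
    by apply: span_sub y2P => _ [p [up pu p0 _] <-]; apply: span_gen; exists p.
  rewrite /= yE numulDr numulZr lvertex_idem; congr (_ + _).
  apply: (closed_lvertex _).1.
  by apply: span_sub y2P => _ [p [up pu p0 _] <-]; apply: span_gen; exists p.
move: yE; rewrite c0 scale0r add0r => yE; subst y2.
have [e ey] : exists e, lghost e ** y <> 0.
  apply: contrapT => ney; apply: y0.
  have [|s _ ->] := @positive_expand y.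
    by apply: span_sub y2P => _ [p [up _ p0 _] <-]; apply: span_gen;
      exists u, p.
  rewrite big1 // => e _; have -> : lghost e ** y = 0.
    by apply: contrapT => ey; apply: ney; exists e.
  by rewrite numulr0.
have [q [d [z [eq qv d0 zP qE]]]] := IH _ _ (lghost_lpaths e y2P) ey.
have eu : src e = u.
  apply: contrapT => eu; apply: ey;
    elim: y2P => [|a _ x [[|f p] [//= /andP[/eqP fu fp] _ _ _] <-] _ IHx].
    by rewrite numulr0.
  rewrite /= numulDr IHx addr0 numulZr numulA lghost_ledge.
  by case: eqP => [ef|_]; [case: eu; rewrite ef|rewrite numul0r scaler0].
exists (e :: q), d, z; split=> //=; first by rewrite eu eqxx.
by rewrite -numulA.
Qed.

(** If [y] were nonzero, reducing it to [c *: lvertex v + z] and conjugating by [f] would give [c]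
    times the range of [f] plus positive paths, equal to 0 although [c] is not. *)
Lemma lpaths_ledge_eq0 u v y f : src f = v -> span (lpaths u v) y ->
  y ** ledge f = 0 -> y = 0.
Proof.
move=> fv yP yf; apply: contrapT => y0.
have [q [c [z [_ _ c0 zP qE]]]] := lpaths_reduction yP y0; apply: c0.
have : lghost f ** (gpath u q ** y) ** ledge f = 0.
  by rewrite -!numulA yf !numulr0.
rewrite qE numulDr numulDl numulZr numulZl -fv lghost_src lghost_ledge eqxx.
apply: lvertex_positive.
move: zP; rewrite -fv; elim=> [|a _ x [[|e p] [//= /andP[_ ep] pv _] <-] _ IH].
  by rewrite numulr0 numul0r; exact: span0.
rewrite numulDr numulDl; apply: spanD => //; rewrite numulZr numulZl;
  apply: spanZ.
rewrite /= numulA lghost_ledge; case: eqP => [fe|_]; last by rewrite !numul0r;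
  exact: span0.
subst e; rewrite lpath_src //.
have pfE : is_path (rng f) (p ++ [:: f]) by rewrite is_path_cat ep /= pv eqxx.
apply: span_gen; exists (rng f), (p ++ [:: f]); split=> //; first by case: (p).
by rewrite lpath_cat //= ledge_rng.
Qed.

(** Induction on the maximal length of the ghost parts: right multiplication by an edge that does
    not kill [x] shortens them. If all edges leaving [v] kill [x], then [v] has to be a sink, where
    ghost parts are trivial. *)
Lemma ghost_elimination u v (x : L) :
  span [set x | exists p q, [/\ is_path u p, is_path v q,
    target u p = target v q &
    x = lpath u p ** gpath v q]] x -> x <> 0 ->
  exists w q, [/\ is_path v q, x ** lpath v q <> 0 & span (lpaths u w) (x **
    lpath v q)].
Proof.
move=> xP.
pose M v N := (fun pq => lpath u pq.1 ** gpath v pq.2) @` [set pq | [/\ is_path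
  u pq.1,
  is_path v pq.2, target u pq.1 = target v pq.2 & (size pq.2 <= N)%N]].
have {xP} [N xN] : exists N, span (M v N) x.
  have : span ((fun pq => lpath u pq.1 ** gpath v pq.2) @` [set pq | [/\
    is_path u pq.1,
      is_path v pq.2 & target u pq.1 = target v pq.2]]) x.
    by apply: span_sub xP => _ [p [q [up vq pq ->]]]; apply: span_gen;
      exists (p, q).
  move=> /(span_bound (fun pq => size pq.2))[N /(_ N (leqnn _))] xN; exists N.
  by apply: span_sub xN => _ [pq [[up vq pqE] qN] <-]; apply: span_gen;
    exists pq.
have xv w n (z : L) : span (M w n) z -> z ** lvertex w = z.
  elim=> [|c _ z' [[p q] /= [up vq pq qN] <-] _ IH]; first by rewrite numul0r.
  by rewrite numulDl IH numulZl -numulA gpath_src.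
elim: N v x xN => [|N IH] v x xN x0.
  exists v, [::] => /=; rewrite (xv _ _ _ xN); split=> //.
  apply: span_sub xN => _ [[p [|e q]] [//= up _ pv _] <-].
  by rewrite /= -pv lpath_tgt; apply: span_gen; exists p.
have [[e ev xe]|nxe] := pselect (exists2 e, src e = v & x ** ledge e <> 0).
  have xeP : span (M (rng e) N) (x ** ledge e).
    apply: span_mulr xN => _ [[p [|f q]] [/= up vq pq qN] <-] /=.
      have ue : is_path u (p ++ [:: e]) by rewrite is_path_cat up /= pq ev eqxx.
      apply: span_gen; exists (p ++ [:: e], [::]).
        by split=> //=; rewrite target_cat.
      rewrite /= lpath_cat //= -!numulA; congr (_ ** _).
      by rewrite lvertex_idem ledge_rng -ev src_ledge.
    rewrite -!numulA lghost_ledge; case: eqP => [fe|_];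
      last by rewrite !numulr0; exact: span0.
    subst f; case/andP: vq => _ eq; rewrite gpath_src //.
    by apply: span_gen; exists (p, q).
  have [w [q [eq xq xqP]]] := IH _ _ xeP xe.
  by exists w, (e :: q); rewrite /= ev eqxx numulA.
have {nxe} xe e : src e = v -> x ** ledge e = 0.
  by move=> ev; apply: contrapT => xe; apply: nxe; exists e.
exists v, [::] => /=; rewrite (xv _ _ _ xN); split=> //.
(* Relation (4) writes [x] as a sum of terms [x ** ledge e ** lghost e], all zero. *)
have [rv|nrv] := pselect (regular v).
  case: x0; rewrite -(xv _ _ _ xN) lvertex_CK2 // numul_sumr big_seq big1 // =>
    e.
  by case: rv => fv _; rewrite in_fset_set // => /set_mem ev;
    rewrite numulA xe ?numul0r.
have [|y [z [yP zP xE]]] := span_split (H1 := lpaths u v)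
    (H2 := (fun pq => lpath u pq.1 ** gpath v pq.2) @` [set pq | [/\ is_path u
      pq.1,
  is_path v pq.2 & pq.2 <> [::]]]) _ xN.
  move=> _ [[p [|e q]] [/= up vq pq qN] <-]; last by right; exists (p, e :: q).
  by left; exists p; rewrite //= -pq lpath_tgt.
have [s sP] : exists s : seq (edge E), forall t, uniq t -> {subset s <= t} ->
    z = \sum_(e <- t) z ** ledge e ** lghost e.
  elim: zP => [|c _ z' [[p [|e q]] [//= up vq _] <-] _ [s sz]].
    by exists [::] => t _ _; rewrite big1 // => e _; rewrite !numul0r.
  exists (e :: s) => t ut st.
  have et : e \in t by apply: st; rewrite inE eqxx.
  under eq_bigr do rewrite 2!numulDl 2!numulZl.
  rewrite big_split /= -sz //; last by move=> f fs; apply: st;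
    rewrite inE fs orbT.
  congr (_ + _); rewrite -scaler_sumr; congr (_ *: _).
  rewrite (bigD1_seq e) //= -!numulA [lghost e ** (_ ** _)]numulA lghost_ledge
    eqxx.
  rewrite rng_lghost big1 ?addr0 // => f fe.
  by rewrite -!numulA [lghost e ** (_ ** _)]numulA lghost_ledge eq_sym (negPf
    fe) numul0r !numulr0.
(* At a sink the part [z] with nontrivial ghosts is empty. Otherwise [v] emits infinitely many
   edges. *)
have [out0|/existsNP[f0 /contrapT f0v]] := pselect (forall e, src e <> v).
  suff z0 : z = 0 by rewrite xE z0 addr0.
  elim: zP => // c _ z' [[p [|e q]] [//= _ /andP[/eqP ev _] _] <-] _ _.
  by case/out0: ev.
(* An edge [f] foreign to the ghosts of [z] kills [z], and it kills [x]; so it kills the ghost-free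
   part [y], which must vanish. Then [x = z] is recovered from the products [x ** ledge e], which
   are zero. *)
have [f fs fv] : exists2 f, f \notin s & src f = v.
  apply: contrapT => nf; apply: nrv; split; last by exists f0.
  apply: sub_finite_set (finite_seq s) => e ev /=.
  by apply: contrapT => /negP es; apply: nf; exists e.
have {}sP := sP (undup s) (undup_uniq s) (fun e => _).
have zf : z ** ledge f = 0.
  rewrite sP; last by move=> e; rewrite mem_undup.
  rewrite numul_suml big_seq big1 // => e; rewrite mem_undup => es.
  rewrite -!numulA lghost_ledge; case: eqP => [ef|_]; last by rewrite !numulr0.
  by rewrite -ef es in fs.
have y0 : y = 0.
  by apply: (lpaths_ledge_eq0 fv yP);
    rewrite -[y](addrK z) -xE numulBl zf xe ?subr0.
case: x0; rewrite xE y0 add0r sP; last by move=> e; rewrite mem_undup.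
rewrite big1 // => e _; have -> : z = x by rewrite xE y0 add0r.
have [ev|/eqP/negPf ev] := pselect (src e = v); first by rewrite xe ?numul0r.
rewrite -(xv _ _ _ xN) -src_ledge -!numulA [lvertex v ** _]numulA lvertexE
  eq_sym ev.
by rewrite numul0r !numulr0.
Qed.

End Reduction.

(** * Closed paths and their exits *)

Section Cycles.
Variable E : graph.
Implicit Types (v w : vertex E) (e f : edge E) (p q : seq (edge E)).

(** Holds vacuously when no closed path is based at [v]; a nonzero [z] in the span of
    [closed_paths v] supplies one when it is needed. *)
Definition no_exit v := forall p e q f,
  is_path v (p ++ e :: q) -> target v (p ++ e ::
    q) = v -> src f = src e -> f = e.

Definition path_pow n p := flatten (nseq n p).

Lemma size_path_pow n p : size (path_pow n p) = (n * size p)%N.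
Proof. by elim: n => //= n IH; rewrite size_cat IH mulSn. Qed.

Lemma path_powS n p : path_pow n.+1 p = p ++ path_pow n p.
Proof. by []. Qed.

Lemma path_powD m n p : path_pow (m + n) p = path_pow m p ++ path_pow n p.
Proof. by rewrite /path_pow nseqD flatten_cat. Qed.

Lemma is_path_pow n v p : is_path v p -> target v p = v ->
  is_path v (path_pow n p) /\ target v (path_pow n p) = v.
Proof.
move=> vp pv; elim: n => //= n [vpn pnv].
by rewrite is_path_cat target_cat vp pv vpn pnv.
Qed.

Lemma nth_path_pow x n p j i : (j < n)%N -> (i < size p)%N ->
  nth x (path_pow n p) (j * size p + i) = nth x p i.
Proof.
move=> jn ip; elim: n j jn => // n IH [|j] jn /=; first by rewrite nth_cat ip.
by rewrite nth_cat mulSn -addnA ltnNge leq_addr /= addKn IH.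
Qed.

(* If [t = a ^ M ++ p ++ [:: f]], with [p ++ [:: e]] a prefix of [a], is a
   prefix of [g ++ t], then [t] has period [size g], hence also the common
   period [size g * size a], which brings its last letter [f] back onto [e]. *)
Lemma exit_not_periodic M p e q f (g r : seq (edge E)) :
  let t := path_pow M (p ++ e :: q) ++ rcons p f in
  g <> [::] -> (size g <= M)%N -> g ++ t = t ++ r -> f = e.
Proof.
move=> t; set a := p ++ e :: q in t * => g0 gM gt.
have gpos : (0 < size g)%N by case: (g) g0.
have period m i : (i + m * size g < size t)%N -> nth e t (i + m * size g) = nth
  e t i.
  elim: m => [|m IH] im; first by rewrite addn0.
  have im' : (i + m * size g < size t)%N.
    by apply: leq_ltn_trans im; rewrite leq_add2l leq_mul2r leqnSn orbT.
  rewrite -(IH im').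
  have := congr1 (fun s => nth e s (i + m.+1 * size g)) gt.
  rewrite nth_cat [RHS]nth_cat im ltnNge.
  have -> : (i + m.+1 * size g = size g + (i + m * size g))%N by rewrite mulSn
    addnCA.
  by rewrite leq_addr /= addKn => ->.
have tf : nth e t (M * size a + size p) = f.
  rewrite /t nth_cat size_path_pow ltnNge leq_addr /= addKn nth_rcons ltnn eqxx
    //.
have pa : (size p < size a)%N by rewrite size_cat /= addnS ltnS leq_addr.
have te : nth e t ((M - size g) * size a + size p) = e.
  rewrite /t nth_cat size_path_pow.
  have Mg : (M - size g < M)%N by rewrite ltn_subrL gpos (leq_trans gpos gM).
  have -> : ((M - size g) * size a + size p < M * size a)%N.
    apply: (@leq_trans ((M - size g).+1 * size a));
      last by rewrite leq_mul2r Mg orbT.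
    by rewrite mulSn addnC ltn_add2r.
  by rewrite nth_path_pow // /a nth_cat ltnn subnn.
have iE : ((M - size g) * size a + size p + size a * size g = M * size a + size
  p)%N.
  by rewrite addnAC [(size a * _)%N]mulnC -mulnDl subnK.
rewrite -te -tf -iE period // iE /t size_cat size_path_pow size_rcons.
by rewrite ltn_add2l ltnSn.
Qed.

End Cycles.

Section Exits.
Variables (K : fieldType) (E : graph).
Implicit Types (v w : vertex E) (e f : edge E) (p q : seq (edge E)).
Local Notation L := (leavitt K E).
Local Notation lvertex := (lvertex K).
Local Notation ledge := (ledge K).
Local Notation lghost := (lghost K).
Local Notation lpath := (lpath K).
Local Notation gpath := (gpath K).

(** Conjugation by [t], which runs [M] times around a closed path and then leaves by its exit, kills
    each closed path [g] of length at most [M]: otherwise [t] would be a prefix of [g ++ t], hence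
    periodic, and the exit would be an edge of the closed path. Only the constant term survives. *)
Lemma exit_reduction v c z : ~ no_exit v -> span (@closed_paths K E v) z ->
  exists w (a b : L), a ** (c *: lvertex v + z) ** b = c *: lvertex w.
Proof.
move=> + /(span_bound size)[M /(_ M (leqnn _))] zM.
move=> /existsNP[p] /existsNP[e] /existsNP[q] /existsNP[f] /not_implyP[va].
move=> /not_implyP[av] /not_implyP[fe nfe].
pose t := path_pow M (p ++ e :: q) ++ rcons p f.
have [vM Mv] := is_path_pow M va av.
have vt : is_path v t.
  rewrite is_path_cat vM Mv -cats1 is_path_cat /= fe andbT.
  by move: va; rewrite is_path_cat /= => /and3P[-> ->].
exists (target v t), (gpath v t), (lpath v t).
rewrite numulDr numulDl numulZr numulZl gpath_src // gpath_lpath //.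
suff -> : gpath v t ** z ** lpath v t = 0 by rewrite addr0.
elim: zM => [|d _ x [g [[vg gv g0] gM] <-] _ IH];
  first by rewrite numulr0 numul0r.
rewrite numulDr numulDl IH addr0 numulZr numulZl -numulA.
have -> : lpath v g ** lpath v t = lpath v (g ++ t).
  by rewrite lpath_cat ?gv // is_path_cat vg gv.
have vgt : is_path v (g ++ t) by rewrite is_path_cat vg gv.
have [[r gt]|[r r0 tE]|[s [e1 [f1 [p1 [q1 [tE gtE ef]]]]]]] := path_compare t
  (g ++ t).
- by case: nfe; exact: exit_not_periodic g0 gM gt.
- have := congr1 size tE; rewrite !size_cat.
  by case: (g) g0 => //= ? ? _ /eqP;
    rewrite -addnA addSn addnCA -addnS -[X in X == _]addn0 eqn_add2l.
- by rewrite gtE {1}tE gpath_lpath_neq ?scaler0 // -?gtE -?tE.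
Qed.

Lemma reduction (x : L) : x <> 0 -> exists v c z (a b : L),
  [/\ c <> 0, span (@closed_paths K E v) z, a ** x ** b = c *: lvertex v + z &
      z = 0 \/ no_exit v].
Proof.
move=> /lvertex_neq0_left[u ux]; have [v xv] := lvertex_neq0_right ux.
have [|w [q [vq xq xqP]]] := @ghost_elimination K E u v (lvertex u ** x **
  lvertex v) _ xv.
  elim: (span_monomials x) => [|c _ z [u' [p [v' [q [up vq pq ->]]]]] _ IH].
    by rewrite numulr0 numul0r; exact: span0.
  rewrite numulDr numulDl; apply: spanD => //; rewrite numulZr numulZl;
    apply: spanZ.
  rewrite /monomial numulA lvertex_lpath //; case: eqP => [uE|_]; last first.
    by rewrite !numul0r; exact: span0.
  rewrite -numulA gpath_lvertex //; case: eqP => [vE|_]; last first.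
    by rewrite numulr0; exact: span0.
  by subst u' v'; apply: span_gen; exists p, q.
have [p [c [z [_ _ c0 zP qE]]]] := lpaths_reduction xqP xq.
have [nv|nv] := pselect (no_exit w).
  exists w, c, z, (gpath u p ** lvertex u), (lvertex v ** lpath v q).
  by split=> //; [rewrite -qE -!numulA|right].
have [w' [a [b abE]]] := exit_reduction c nv zP.
exists w', c, 0, (a ** (gpath u p ** lvertex u)), (lvertex v ** lpath v q ** b).
by split; [|exact: span0|rewrite addr0 -abE -qE -!numulA|left].
Qed.

(** Minimality of the left ideal of multiples of [x], in terms of the generator; in this form it
    passes to nonzero multiples on either side. *)
Definition left_minimal (x : L) := x <> 0 /\
  forall a, a ** x <> 0 -> exists b, b ** (a ** x) = x.

Lemma left_minimal_mulr (x b : L) :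
  left_minimal x -> x ** b <> 0 -> left_minimal (x ** b).
Proof.
move=> [x0 xmin] xb; split=> // a axb.
have [|d dE] := xmin a; first by move=> ax; apply: axb;
  rewrite numulA ax numul0r.
by exists d; rewrite [a ** _]numulA numulA dE.
Qed.

Lemma left_minimal_mull (x a : L) :
  left_minimal x -> a ** x <> 0 -> left_minimal (a ** x).
Proof.
move=> [x0 xmin] ax; split=> // d dax.
have [|b bE] := xmin (d ** a); first by rewrite -numulA.
by exists (a ** b); rewrite -numulA [d ** _]numulA bE.
Qed.

Section NoExit.
Variables (v : vertex E) (c0 : seq (edge E)).
Hypotheses (vc0 : is_path v c0) (c0v : target v c0 = v) (c0_neq0 : c0 <> [::]).
Hypothesis nv : no_exit v.

Let closed n := `[< exists c, [/\ is_path v c, target v c = v,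
  c <> [::] & size c = n] >].

Let closed_ex : exists n, closed n.
Proof. by exists (size c0); apply/asboolP; exists c0. Qed.

(** A first difference between [q] and the closed path [p] would be an exit. *)
Lemma no_exit_prefix p q : is_path v p -> target v p = v -> is_path v q ->
  (size q <= size p)%N -> exists r, p = q ++ r.
Proof.
move=> vp pv vq qp.
have [[r rE]|[r r0 rE]|[s [e [f [p1 [q1 [qE pE ef]]]]]]] := path_compare q p.
- by exists r.
- by move: qp; rewrite rE size_cat; case: (r) r0 => //= ? ? _;
  rewrite -[X in (_ <= X)%N]addn0 leq_add2l.
- case: ef; rewrite pE in vp pv; apply: (nv vp pv).
  move: vp vq; rewrite qE !is_path_cat /= => /and3P[_ /eqP <- _].
  by case/and3P=> _ /eqP ->.
Qed.

(** A shortest closed path is a prefix of all nonempty ones; strip it off repeatedly. *)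
Lemma cycle_generator : exists c, [/\ is_path v c, target v c = v, c <> [::] &
  forall p, is_path v p -> target v p = v -> exists n, p = path_pow n c].
Proof.
case: (ex_minnP closed_ex) => n /asboolP[c [vc cv c_neq0 cn]] nmin.
exists c; split=> // p; have [m] := ubnP (size p);
  elim: m p => // m IH p pm vp pv.
have [->|p0] := pselect (p = [::]); first by exists 0%N.
have cp : (size c <= size p)%N by rewrite cn; apply: nmin; apply/asboolP;
  exists p.
have [r pE] := no_exit_prefix vp pv vc cp.
have [|||k rE] := IH r.
- move: pm; rewrite pE size_cat; case: (c) c_neq0 => //= ? ? _.
  by rewrite addSn ltnS; apply: leq_ltn_trans; exact: leq_addl.
- by move: vp; rewrite pE is_path_cat cv => /andP[].
- by move: pv; rewrite pE target_cat cv.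
- by exists k.+1; rewrite path_powS -rE.
Qed.

End NoExit.

End Exits.

(** * Cycles without exits *)

Section CyclePolynomials.
Variables (K : fieldType) (E : graph) (v : vertex E) (c : seq (edge E)).
Local Notation L := (leavitt K E).
Local Notation lvertex := (lvertex K).
Local Notation lpath := (lpath K).
Local Notation gpath := (gpath K).
Hypotheses (vc : is_path v c) (cv : target v c = v) (c_neq0 : c <> [::]).

Definition cycle_pow n : L := lpath v (path_pow n c).

Lemma cycle_powD m n : cycle_pow (m + n) = cycle_pow m ** cycle_pow n.
Proof.
have [vm mv] := is_path_pow m vc cv; have [vn nv] := is_path_pow n vc cv.
by rewrite /cycle_pow path_powD lpath_cat ?mv // is_path_cat vm mv vn.
Qed.

(** Substitution of the cycle for ['X], with [lvertex v] in the place of 1. Negative powers, which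
    are ghost paths, are deliberately avoided. *)
Definition cycle_eval (P : {poly K}) : L := \sum_(i < size P) P`_i *:
  cycle_pow i.

Lemma cycle_evalE N (P : {poly K}) : (size P <= N)%N ->
  cycle_eval P = \sum_(i < N) P`_i *: cycle_pow i.
Proof.
move=> PN; rewrite /cycle_eval (big_ord_widen N (fun i =>
  P`_i *: cycle_pow i)) //.
rewrite big_mkcond /=; apply: eq_bigr => i _; case: ltnP => // Pi.
by rewrite nth_default ?scale0r.
Qed.

Lemma cycle_evalP a P Q : cycle_eval (a *: P + Q) = a *:
  cycle_eval P + cycle_eval Q.
Proof.
pose N := maxn (size P) (size Q).
have PN : (size P <= N)%N by rewrite leq_maxl.
have QN : (size Q <= N)%N by rewrite leq_maxr.
rewrite (@cycle_evalE N); last first.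
  rewrite (leq_trans (size_polyD _ _)) // geq_max QN andbT.
  by rewrite (leq_trans (size_scale_leq _ _)).
rewrite (cycle_evalE PN) (cycle_evalE QN) scaler_sumr -big_split /=.
by apply: eq_bigr => i _; rewrite coefD coefZ scalerDl scalerA.
Qed.

Lemma cycle_evalXn n : cycle_eval 'X^n = cycle_pow n.
Proof.
rewrite (@cycle_evalE n.+1) ?size_polyXn // big_ord_recr /= coefXn eqxx scale1r.
rewrite big1 ?add0r // => i _; rewrite coefXn.
by rewrite (ltn_eqF (ltn_ord i)) scale0r.
Qed.

Lemma cycle_evalMX P : cycle_eval (P * 'X) = cycle_eval P ** cycle_pow 1.
Proof.
rewrite (@cycle_evalE (size P).+1); last first.
  by rewrite (leq_trans (size_polyMleq _ _)) // size_polyX addn2.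
rewrite big_ord_recl coefMX eqxx scale0r add0r numul_suml.
by apply: eq_bigr => i _; rewrite coefMX /= numulZl -cycle_powD addn1.
Qed.

Lemma cycle_eval0 : cycle_eval 0 = 0.
Proof. by rewrite /cycle_eval size_poly0 big_ord0. Qed.

Lemma cycle_evalZ a P : cycle_eval (a *: P) = a *: cycle_eval P.
Proof. by rewrite -[a *: P]addr0 cycle_evalP cycle_eval0 addr0. Qed.

Lemma cycle_evalD P Q : cycle_eval (P + Q) = cycle_eval P + cycle_eval Q.
Proof. by rewrite -[P]scale1r cycle_evalP !scale1r. Qed.

Lemma cycle_powC n P : cycle_eval P ** cycle_pow n = cycle_pow n ** cycle_eval
  P.
Proof.
rewrite numul_suml numul_sumr; apply: eq_bigr => i _.
by rewrite numulZl numulZr -!cycle_powD addnC.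
Qed.

Lemma lvertex_cycle_eval P : lvertex v ** cycle_eval P = cycle_eval P.
Proof.
rewrite numul_sumr; apply: eq_bigr => i _.
by rewrite numulZr lpath_src //; case: (is_path_pow i vc cv).
Qed.

Lemma cycle_evalM P Q : cycle_eval (P * Q) = cycle_eval P ** cycle_eval Q.
Proof.
elim/poly_ind: P => [|P a IH]; first by rewrite mul0r cycle_eval0 numul0r.
have aE : a%:P = a *: 'X^0 :> {poly K} by rewrite expr0 alg_polyC.
rewrite mulrDl -mulrA [_ * Q]mulrC mulrA !cycle_evalD numulDl !cycle_evalMX IH.
rewrite -!numulA cycle_powC; congr (_ + _).
by rewrite mul_polyC aE !cycle_evalZ cycle_evalXn numulZl lvertex_cycle_eval.
Qed.

(** The constant coefficient is zero by [lvertex_positive]; the ghost of the cycle then cancels one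
    factor ['X]. *)
Lemma cycle_eval_inj P : cycle_eval P = 0 -> P = 0.
Proof.
elim/poly_ind: P => // P a IH.
have aE : a%:P = a *: 'X^0 :> {poly K} by rewrite expr0 alg_polyC.
rewrite cycle_evalD cycle_evalMX aE cycle_evalZ cycle_evalXn addrC => Pa.
have a0 : a = 0.
  apply: (lvertex_positive _ Pa); rewrite numul_suml; apply: span_sum => i _.
  rewrite numulZl -cycle_powD addn1; apply/spanZ/span_gen.
  exists v, (path_pow i.+1 c); split=> //;
    first by case: (is_path_pow i.+1 vc cv).
  by rewrite path_powS; case: (c) c_neq0.
move: Pa; rewrite a0 !scale0r add0r addr0 => Pc.
rewrite IH ?mul0r //; have := Pc;
  rewrite cycle_powC => /(congr1 (numul (gpath v c))).
by rewrite numulr0 /cycle_pow /path_pow /= cats0 numulA gpath_lpath // cv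
  lvertex_cycle_eval.
Qed.

Hypothesis nv : no_exit v.
Hypothesis gen_c : forall p, is_path v p -> target v p = v -> exists n,
  p = path_pow n c.

Lemma cycle_eval_surj a z : span (@closed_paths K E v) z ->
  exists P, a *: lvertex v + z = cycle_eval P.
Proof.
elim=> [|d _ x [p [vp pv _] <-] _ [P PE]].
  by exists (a *: 'X^0); rewrite cycle_evalZ cycle_evalXn addr0.
have [n pn] := gen_c vp pv; exists (d *: 'X^n + P).
by rewrite cycle_evalP cycle_evalXn -PE pn addrCA.
Qed.

(** Plays the role of clearing denominators in Laurent polynomials: every ghost part starting at [v]
    is the ghost of a prefix of a long enough power of the cycle, and is absorbed by it. *)
Lemma cycle_clear_ghosts (b : L) :
  exists N P, lvertex v ** b ** cycle_pow N = cycle_eval P.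
Proof.
suff [N0 N0P] : exists N0, forall N, (N0 <= N)%N ->
    exists P, lvertex v ** b ** cycle_pow N = cycle_eval P.
  by have [P PE] := N0P N0 (leqnn _); exists N0, P.
elim: (span_monomials b) => [|d _ z [u [p [w [q [up wq pq ->]]]]] _ [N0 N0P]].
  by exists 0%N => N _; exists 0; rewrite numulr0 numul0r cycle_eval0.
exists (maxn N0 (size q)) => N; rewrite geq_max => /andP[/N0P[P PE] qN].
suff [Q QE] : exists Q, lvertex v ** monomial K u p w q ** cycle_pow N =
  cycle_eval Q.
  by exists (d *: Q + P); rewrite numulDr numulDl PE numulZr numulZl QE
    cycle_evalP.
have [vN Nv] := is_path_pow N vc cv.
rewrite /monomial numulA lvertex_lpath //; case: eqP => [vu|_]; last first.
  by exists 0; rewrite !numul0r cycle_eval0.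
subst u; have [wv|wv] := pselect (w = v); last first.
  by exists 0; rewrite -numulA gpath_lpath0 // numulr0 cycle_eval0.
subst w; have [|r rE] := no_exit_prefix nv vN Nv wq.
  rewrite size_path_pow (leq_trans qN) //.
  by case: (c) c_neq0 => // ? ? _; rewrite leq_pmulr.
move: vN Nv; rewrite -numulA /cycle_pow rE => vN Nv;
  rewrite gpath_lpath_cat // -pq.
have vpr : is_path v (p ++ r).
  by rewrite is_path_cat up pq; move: vN; rewrite is_path_cat => /andP[].
rewrite -lpath_cat //; have [|n ->] := gen_c vpr.
  by rewrite target_cat pq -target_cat.
by exists 'X^n; rewrite cycle_evalXn.
Qed.

Lemma cycle_eval_not_minimal a z : a <> 0 -> span (@closed_paths K E v) z ->
  ~ left_minimal (a *: lvertex v + z).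
Proof.
move=> a0 zP; have [Y YE] := cycle_eval_surj a zP; rewrite YE => -[Y0 Ymin].
have Y_neq0 : Y != 0 by apply/eqP => Yz; apply: Y0; rewrite Yz cycle_eval0.
(* The factor [1 - 'X] has the root 1, whereas ['X^N] takes the value 1 there; so no denominator can
   make it invertible. *)
have X1 : 1 - 'X != 0 :> {poly K}.
  apply/eqP => /(congr1 (fun P => P.[0])); rewrite !hornerE ?subr0 => /eqP.
  by rewrite oner_eq0.
have [|b bE] := Ymin (cycle_eval (1 - 'X)).
  rewrite -cycle_evalM => /cycle_eval_inj/eqP.
  by rewrite mulf_eq0 (negPf X1) (negPf Y_neq0).
have [N [B BE]] := cycle_clear_ghosts b.
(* The power of the cycle commutes with polynomials, so it can be moved next to [b], where it clears
   the ghosts. *)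
have : cycle_eval ('X^N * Y) = cycle_eval (B * ((1 - 'X) * Y)).
  rewrite [LHS]cycle_evalM cycle_evalXn -cycle_powC [RHS]cycle_evalM -BE.
  rewrite -[RHS]numulA -cycle_powC cycle_evalM.
  by rewrite -[RHS]numulA [b ** _]numulA bE numulA lvertex_cycle_eval.
move=> /eqP; rewrite -subr_eq0 => /eqP.
have subE P Q : cycle_eval P - cycle_eval Q = cycle_eval (P - Q).
  by rewrite cycle_evalD -[- Q]scaleN1r cycle_evalZ scaleN1r.
rewrite subE => /cycle_eval_inj/eqP;
  rewrite subr_eq0 mulrA => /eqP/(mulIf Y_neq0).
move=> /(congr1 (fun P => P.[1])); rewrite !hornerE ?expr1n subrr mulr0 => /eqP.
by rewrite oner_eq0.
Qed.

End CyclePolynomials.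

(** * Vertices that generate minimal left ideals *)

Section MinimalVertices.
Variables (K : fieldType) (E : graph).
Implicit Types (v w : vertex E) (e f : edge E) (p q : seq (edge E)).
Local Notation L := (leavitt K E).
Local Notation lvertex := (lvertex K).

Lemma no_exit_not_minimal v c a z :
  is_path v c -> target v c = v -> c <> [::] ->
  no_exit v -> a <> 0 -> span (@closed_paths K E v) z ->
  ~ left_minimal (a *: lvertex v + z).
Proof.
move=> vc cv c0 nv a0 zP; have [d [vd dv d0 dgen]] := cycle_generator vc cv c0
  nv.
exact: (cycle_eval_not_minimal vd dv d0 nv dgen a0 zP).
Qed.

Lemma left_minimal_vertex (x : L) : left_minimal x ->
  exists v (a b : L), a ** x ** b = lvertex v.
Proof.
move=> xmin; have [v [c [z [a [b [c0 zP xE zv]]]]]] := reduction xmin.1.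
have [z0|z0] := pselect (z = 0).
  exists v, (c^-1 *: a), b; rewrite !numulZl xE z0 addr0 scalerA mulVf ?scale1r
    //.
  exact/eqP.
case: zv => // nv; exfalso.
have [d [vd dv d0]] : exists d, [/\ is_path v d, target v d = v & d <> [::]].
  apply: contrapT => nd; apply: z0; elim: zP => // ? _ ? [d dP <-] _ _.
  by case: nd; exists d.
apply: (no_exit_not_minimal vd dv d0 nv c0 zP); rewrite -xE.
have cz : a ** x ** b <> 0.
  rewrite xE => /lvertex_positive-/(_ (closed_positive zP)); exact: c0.
apply: (left_minimal_mulr _ cz); apply: left_minimal_mull => // ax.
by apply: cz; rewrite ax numul0r.
Qed.

Definition line_point v := (forall p e f, is_path v p -> src e = target v p ->
    src f = target v p -> e = f) /\
  (forall p q, is_path v (p ++ q) -> target v (p ++ q) = target v p -> q =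
    [::]).

(** Minimality spreads along paths, so both conditions may be tested at one vertex. A cycle would
    have no exit by the first condition, and is then excluded by [no_exit_not_minimal] applied to
    the vertex itself. *)
Lemma minimal_vertex_line v : left_minimal (lvertex v) -> line_point v.
Proof.
move=> vmin.
have pmin p : is_path v p -> left_minimal (lvertex (target v p)).
  move=> vp; rewrite -(@gpath_lpath K) //; apply: left_minimal_mulr.
    rewrite -gpath_src //; apply: left_minimal_mull vmin _.
    rewrite gpath_src // => pz; apply: (@lvertex_neq0 K E (target v p)).
    by rewrite -gpath_lpath // pz numul0r.
  by rewrite gpath_lpath //; exact: lvertex_neq0.
(* By minimality [lvertex u] is a left multiple of the ghost of [e], which annihilates any other
   edge [f]; so [f] itself would vanish. *)
have bif u e f : left_minimal (lvertex u) -> src e = u -> src f = u -> e = f.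
  move=> [_ umin] eu fu; apply: contrapT => ef.
  have ge : lghost K e ** lvertex u = lghost K e by rewrite -eu lghost_src.
  have [|b] := umin (lghost K e).
    rewrite ge => ez; apply: (@lvertex_neq0 K E (rng e)).
    by have := lghost_ledge K e e; rewrite eqxx ez numul0r.
  rewrite ge => bE; apply: (@lvertex_neq0 K E (rng f)).
  have := lghost_ledge K f f; rewrite eqxx -[X in _ ** X]src_ledge fu -bE.
  rewrite -!numulA lghost_ledge; case: eqP => // _; rewrite !numulr0.
  by move=> <-.
split=> [p e f vp|p q]; first exact/bif/pmin.
rewrite is_path_cat target_cat => /andP[vp pq] qp; apply: contrapT => q0.
set u := target v p in pq qp *;
  have umin : left_minimal (lvertex u) by exact: pmin.
have nu : no_exit u.
  move=> p1 e q1 f up1 _ fe.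
  move: up1; rewrite is_path_cat /= => /andP[up1 /andP[/eqP eu _]].
  apply: (bif (target u p1)); rewrite ?fe //.
  have := pmin (p ++ p1); rewrite is_path_cat target_cat -/u vp; exact.
apply: (no_exit_not_minimal pq qp q0 nu (a := 1) (z := 0));
  last by rewrite scale1r addr0.
  by apply/eqP/oner_neq0.
exact: span0.
Qed.

End MinimalVertices.

(** * Line points *)

Section LinePoints.
Variables (K : fieldType) (E : graph).
Implicit Types (u v w : vertex E) (e f : edge E) (p q : seq (edge E)).
Local Notation L := (leavitt K E).
Local Notation lvertex := (lvertex K).
Local Notation ledge := (ledge K).
Local Notation lghost := (lghost K).
Local Notation lpath := (lpath K).
Local Notation gpath := (gpath K).

Lemma line_point_target v p : line_point v -> is_path v p -> line_point (target
  v p).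
Proof.
move=> [bif acyc] vp; split=> [q e f pq|q r].
  by rewrite -target_cat; apply: bif; rewrite is_path_cat vp.
by rewrite -!target_cat catA => qr; apply: acyc; rewrite -catA is_path_cat vp.
Qed.

(** Each vertex that the path leaves emits one edge only, so relation (4) has a single summand there
    and the product telescopes. *)
Lemma line_point_path v p : line_point v -> is_path v p ->
  lpath v p ** gpath v p = lvertex v.
Proof.
elim: p v => [|e p IH] v lv /=; first by rewrite lvertex_idem.
case/andP=> /eqP ev vp; rewrite -numulA [lpath _ _ ** _]numulA IH //;
  last first.
  by apply: (@line_point_target v [:: e] lv); rewrite /= ev eqxx.
rewrite rng_lghost -ev lvertex_CK2_single // => f fe.
by apply: (lv.1 [::]) => //=; rewrite ?fe ev.
Qed.

(** Two paths from [v] with a common end are comparable for lack of bifurcations, and equal for lack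
    of cycles; such a monomial is [lvertex v]. *)
Lemma line_point_corner v (z : L) : line_point v ->
  exists c, lvertex v ** z ** lvertex v = c *: lvertex v.
Proof.
move=> lv; elim: (span_monomials z) =>
  [|c _ y [u [p [w [q [up wq pq ->]]]]] _ [d dE]].
  by exists 0; rewrite numulr0 numul0r scale0r.
rewrite numulDr numulDl dE numulZr numulZl.
suff [b ->] : exists b, lvertex v ** monomial K u p w q ** lvertex v = b *:
  lvertex v.
  by exists (c * b + d); rewrite scalerDl scalerA.
rewrite /monomial numulA lvertex_lpath //; case: eqP => [vu|_]; last first.
  by exists 0; rewrite !numul0r scale0r.
rewrite -numulA gpath_lvertex //; case: eqP => [vw|_]; last first.
  by exists 0; rewrite !numulr0 scale0r.
subst u w; exists 1; rewrite scale1r.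
have [[r qE]|[r r0 pE]|[s [e [f [p1 [q1 [pE qE ef]]]]]]] := path_compare p q.
- subst q; rewrite (lv.2 _ _ wq (esym pq)) cats0; exact: line_point_path.
- by subst p; case: r0; exact: (lv.2 _ _ up pq).
- subst p q; case: ef; move: up wq; rewrite !is_path_cat /=.
  case/and3P=> vs /eqP es _ /and3P[_ /eqP fs _].
  exact: (lv.1 s).
Qed.

(* Murray-von Neumann equivalence of the idempotents [v] and [w]. *)
Record vertex_equiv_by v w (t t' : L) : Prop := {
  equiv_srcl : lvertex v ** t = t;
  equiv_tgtl : t ** lvertex w = t;
  equiv_srcr : t' ** lvertex v = t';
  equiv_tgtr : lvertex w ** t' = t';
  equiv_mulVr : t ** t' = lvertex v;
  equiv_mulVl : t' ** t = lvertex w }.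

Definition vertex_equiv v w := exists t t' : L, vertex_equiv_by v w t t'.

Lemma vertex_equiv_sym v w : vertex_equiv v w -> vertex_equiv w v.
Proof. by move=> [t [t' [? ? ? ? ? ?]]]; exists t', t. Qed.

Lemma vertex_equiv_trans u v w :
  vertex_equiv u v -> vertex_equiv v w -> vertex_equiv u w.
Proof.
move=> [s [s' [us sv s'u vs' ss' s's]]] [t [t' [vt tw t'v wt' tt' t't]]].
exists (s ** t), (t' ** s'); split.
- by rewrite numulA us.
- by rewrite -numulA tw.
- by rewrite -numulA s'u.
- by rewrite numulA wt'.
- by rewrite -numulA [t ** _]numulA tt' vs' ss'.
- by rewrite -numulA [s' ** _]numulA s's vt t't.
Qed.

Lemma vertex_equiv_path v p : line_point v -> is_path v p -> vertex_equiv v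
  (target v p).
Proof.
move=> lv vp; exists (lpath v p), (gpath v p); split.
- exact: lpath_src.
- exact: lpath_tgt.
- exact: gpath_src.
- exact: gpath_tgt.
- exact: line_point_path.
- exact: gpath_lpath.
Qed.

(** [choose] depends only on the extension of the predicate, so equivalent line points receive the
    same representative and blocks are compared by plain equality. *)
Definition line_repr v : vertex E :=
  choose (fun w => `[< line_point w /\ vertex_equiv v w >]) v.

Lemma vertex_equiv_refl v : line_point v -> vertex_equiv v v.
Proof. by move=> lv; exact: (@vertex_equiv_path v [::]). Qed.

Lemma line_reprP v : line_point v ->
  line_point (line_repr v) /\ vertex_equiv v (line_repr v).
Proof.
move=> lv; suff /asboolP : `[< line_point (line_repr v) /\
  vertex_equiv v (line_repr v) >] by [].
apply: (@chooseP _ (fun w => `[< line_point w /\ vertex_equiv v w >])).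
by apply/asboolP; split=> //; exact: vertex_equiv_refl.
Qed.

Lemma line_repr_equiv v w : line_point v -> line_point w ->
  vertex_equiv v w -> line_repr v = line_repr w.
Proof.
move=> lv lw vw; rewrite /line_repr.
have PE : (fun u => `[< line_point u /\ vertex_equiv v u >]) =1
          (fun u => `[< line_point u /\ vertex_equiv w u >]).
  move=> u; apply: asbool_equiv_eq; split=> -[lu vu]; split=> //.
    exact: vertex_equiv_trans (vertex_equiv_sym vw) vu.
  exact: vertex_equiv_trans vw vu.
rewrite (eq_choose PE); apply: choose_id; apply/asboolP.
  by split=> //; exact: vertex_equiv_sym.
by split=> //; exact: vertex_equiv_refl.
Qed.

(** Stopping at the first line point makes distinct entries from one vertex incomparable as
    prefixes, whence their orthogonality. *)
Definition entry v p : Prop := [/\ is_path v p, line_point (target v p) &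
  forall p1 p2, p = p1 ++ p2 -> p2 <> [::] -> ~ line_point (target v p1)].

Lemma entry_decomposition v p : is_path v p -> line_point (target v p) ->
  exists p1 p2, p = p1 ++ p2 /\ entry v p1.
Proof.
have [m] := ubnP (size p); elim: m p => // m IH p pm vp lp.
have [[p1 [p2 [pE p20 l1]]]|np] := pselect (exists p1 p2,
    [/\ p = p1 ++ p2, p2 <> [::] & line_point (target v p1)]); last first.
  exists p, [::]; rewrite cats0; split=> //; split=> // p1 p2 pE p20 l1.
  by apply: np; exists p1, p2.
have [||q1 [q2 [p1E eq1]]] := IH p1 _ _ l1.
- move: pm; rewrite pE size_cat; case: (p2) p20 => // ? ? _ /=.
  by rewrite addnS ltnS; apply: leq_ltn_trans; exact: leq_addr.
- by move: vp; rewrite pE is_path_cat => /andP[].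
by exists q1, (q2 ++ p2); rewrite catA -p1E.
Qed.

Definition entry_path := {x : vertex E * seq (edge E) | `[< entry x.1 x.2 >]}.
HB.instance Definition _ := Countable.on entry_path.
Implicit Types x y : entry_path.

Lemma entry_pathP x : entry (val x).1 (val x).2.
Proof. exact/asboolP/(valP x). Qed.

Definition entry_end x := target (val x).1 (val x).2.
Definition entry_class x := line_repr (entry_end x).

Lemma entry_end_line x : line_point (entry_end x).
Proof. by have [] := entry_pathP x. Qed.

Lemma entry_class_line x : line_point (entry_class x).
Proof. by have [] := line_reprP (entry_end_line x). Qed.

(** One equivalence to the representative is fixed for each line point; the pair [(0, 0)] only makes
    the choice total. *)
Lemma connector_subproof v : exists tt' : L * L,
  line_point v -> vertex_equiv_by v (line_repr v) tt'.1 tt'.2.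
Proof.
have [lv|nlv] := pselect (line_point v); last by exists (0, 0).
by have [_ [t [t' tt']]] := line_reprP lv; exists (t, t').
Qed.

Definition connector v : L * L := projT1 (cid (connector_subproof v)).

Lemma connectorP v : line_point v ->
  vertex_equiv_by v (line_repr v) (connector v).1 (connector v).2.
Proof. exact: (projT2 (cid (connector_subproof v))). Qed.

(** Column and row of a matrix unit: both are carried to the representative of the block, where they
    meet. *)
Definition entry_elt x : L :=
  lpath (val x).1 (val x).2 ** (connector (entry_end x)).1.
Definition entry_coelt x : L :=
  (connector (entry_end x)).2 ** gpath (val x).1 (val x).2.

Lemma entry_elt_class x : entry_elt x ** lvertex (entry_class x) = entry_elt x.
Proof.
by rewrite /entry_elt -numulA (equiv_tgtl (connectorP (entry_end_line x))).
Qed.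

Lemma entry_coelt_class x : lvertex (entry_class x) ** entry_coelt x =
  entry_coelt x.
Proof.
by rewrite /entry_coelt numulA (equiv_tgtr (connectorP (entry_end_line x))).
Qed.

Lemma entry_coelt_elt x : entry_coelt x ** entry_elt x = lvertex (entry_class
  x).
Proof.
have [xp _ _] := entry_pathP x; have cx := connectorP (entry_end_line x).
rewrite /entry_coelt /entry_elt -numulA [gpath _ _ ** _]numulA gpath_lpath //.
by rewrite (equiv_srcl cx) (equiv_mulVl cx).
Qed.

Lemma entry_coelt_elt_neq x y : x <> y -> entry_coelt x ** entry_elt y = 0.
Proof.
move=> xy; rewrite /entry_coelt /entry_elt -numulA [gpath _ _ ** _]numulA.
suff -> : gpath (val x).1 (val x).2 ** lpath (val y).1 (val y).2 = 0.
  by rewrite numul0r numulr0.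
case: x y xy (entry_pathP x) (entry_pathP y) => [[v p] xP] [[w q] yP] /= xy.
move=> [vp lp pmin] [wq lq qmin]; have [vw|vw] := pselect (v = w); last first.
  exact: gpath_lpath0.
subst w; have [[r qE]|[r r0 pE]|[s [e [f [p1 [q1 [pE qE ef]]]]]]] :=
  path_compare p q.
- have [r0|r0] := pselect (r = [::]); last by case: (qmin _ _ qE r0).
  by case: xy; apply: val_inj; rewrite /= qE r0 cats0.
- by case: (pmin _ _ pE r0).
- by subst p q; exact: gpath_lpath_neq.
Qed.

Definition entry_unit x y : L := entry_elt x ** entry_coelt y.

Lemma entry_mxunits : mxunits entry_class entry_unit.
Proof.
split=> [x y z xy yz|x y z w _ _ yz|x x0]; rewrite /entry_unit.
- rewrite -numulA [entry_coelt y ** _]numulA entry_coelt_elt.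
  by rewrite yz entry_coelt_class.
- rewrite -numulA [entry_coelt y ** _]numulA entry_coelt_elt_neq //.
  by rewrite numul0r numulr0.
- apply: (@lvertex_neq0 K E (entry_class x)).
  rewrite -lvertex_idem -{1}entry_coelt_elt -entry_coelt_elt -numulA.
  by rewrite [entry_elt x ** (_ ** _)]numulA -/(entry_unit x x) x0 numul0r
    numulr0.
Qed.

Local Notation I := (span (block_units entry_class entry_unit)).

(** The path part of a monomial ending in a line point is cut at its first line point. The initial
    piece is an entry, and the two halves of its connector, whose product is a vertex, are inserted
    at the cut. *)
Lemma entry_factor v (a : L) : line_point v ->
  span [set z | exists x s, entry_class x = line_repr v /\
     z = entry_elt x ** (lvertex (entry_class x) ** s ** lvertex v)] (a **
       lvertex v).
Proof.
move=> lv; elim: (span_monomials a) =>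
  [|c _ z [u [p [w [q [up wq pq ->]]]]] _ IH].
  by rewrite numul0r; exact: span0.
rewrite numulDl numulZl; apply: spanD => //; apply: spanZ.
rewrite /monomial -numulA gpath_lvertex //; case: eqP => [vw|_]; last first.
  by rewrite numulr0; exact: span0.
subst w; have lq : line_point (target v q) by exact: line_point_target.
have lp : line_point (target u p) by rewrite pq.
have [p1 [p2 [pE up1]]] := entry_decomposition up lp.
pose x : entry_path := exist _ (u, p1) (asboolT up1).
have xE : entry_end x = target u p1 by [].
have cx := connectorP (entry_end_line x).
have vp2 : is_path (entry_end x) p2 by move: up;
  rewrite pE is_path_cat => /andP[].
apply: span_gen; exists x, ((connector (entry_end x)).2 ** lpath (entry_end x)
  p2 ** gpath v q).
split.
  transitivity (line_repr (target u p)).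
    apply: line_repr_equiv => //; first exact: entry_end_line.
    rewrite pE target_cat; apply: vertex_equiv_path => //;
      exact: entry_end_line.
  rewrite pq; apply: line_repr_equiv => //; apply: vertex_equiv_sym.
  exact: vertex_equiv_path.
rewrite pE lpath_cat -?pE // /entry_elt -!numulA; congr (_ ** _).
rewrite gpath_src // [lvertex _ ** _]numulA (equiv_tgtr cx).
by rewrite [RHS]numulA (equiv_mulVr cx) [RHS]numulA lpath_src.
Qed.

End LinePoints.

(** * The socle *)

Section Socle.
Variables (K : fieldType) (E : graph).
Implicit Types (v w : vertex E) (x y : entry_path E).
Local Notation L := (leavitt K E).
Local Notation lpath := (lpath K).
Local Notation gpath := (gpath K).
Local Notation lvertex := (lvertex K).
Local Notation entry_unit := (@entry_unit K E).
Local Notation entry_class := (@entry_class K E).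
Local Notation entry_elt := (@entry_elt K E).
Local Notation entry_coelt := (@entry_coelt K E).
Local Notation line_repr := (@line_repr K E).
Local Notation I := (span (block_units entry_class entry_unit)).

Lemma entry_cofactor v (a : L) : line_point v ->
  span [set z | exists x s, entry_class x = line_repr v /\
     z = lvertex v ** s ** lvertex (entry_class x) ** entry_coelt x] (lvertex v
       ** a).
Proof.
move=> lv; elim: (span_monomials a) =>
  [|c _ z [w [q [u [p [wq up qp ->]]]]] _ IH].
  by rewrite numulr0; exact: span0.
rewrite numulDr numulZr; apply: spanD => //; apply: spanZ.
rewrite /monomial numulA lvertex_lpath //; case: eqP => [vw|_]; last first.
  by rewrite numul0r; exact: span0.
subst w; have lq : line_point (target v q) by exact: line_point_target.
have lp : line_point (target u p) by rewrite -qp.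
have [p1 [p2 [pE up1]]] := entry_decomposition up lp.
pose x : entry_path E := exist _ (u, p1) (asboolT up1).
have cx := connectorP K (entry_end_line x).
have xp2 : is_path (entry_end x) p2 by move: up;
  rewrite pE is_path_cat => /andP[].
apply: span_gen; exists x, (lpath v q ** (gpath (entry_end x) p2 ** (connector
  K (entry_end x)).1)).
split.
  transitivity (line_repr (target u p)).
    apply: line_repr_equiv => //; first exact: entry_end_line.
    rewrite pE target_cat; apply: vertex_equiv_path => //;
      exact: entry_end_line.
  rewrite -qp; apply: line_repr_equiv => //; apply: vertex_equiv_sym.
  exact: vertex_equiv_path.
rewrite pE gpath_cat -?pE // /entry_coelt !numulA; congr (_ ** _).
rewrite lpath_src // -[_ ** lvertex _]numulA (equiv_tgtl cx).
by rewrite -[RHS]numulA (equiv_mulVr cx) -[RHS]numulA gpath_src.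
Qed.

(** Split the vertex as its own square and factor both sides through entries: what remains in the
    middle lies in the corner of a line point and is a scalar. *)
Lemma line_ideal v (a b : L) : line_point v -> I (a ** lvertex v ** b).
Proof.
move=> lv; rewrite -lvertex_idem [a ** _]numulA -numulA.
apply: span_mul (entry_factor a lv) (entry_cofactor b lv).
move=> _ _ [x [s [xv ->]]] [y [s' [yv ->]]].
have [c cE] := line_point_corner (s ** lvertex v ** s') (entry_class_line K x).
have -> : entry_elt x ** (lvertex (entry_class x) ** s ** lvertex v) **
    (lvertex v ** s' ** lvertex (entry_class y) ** entry_coelt y) =
    entry_elt x ** (lvertex (entry_class x) ** (s ** lvertex v ** s') **
      lvertex (entry_class x)) ** entry_coelt y.
  rewrite yv -xv -!numulA; congr (_ ** (_ ** (_ ** _))).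
  by rewrite [lvertex v ** (lvertex v ** _)]numulA lvertex_idem.
rewrite cE numulZr numulZl entry_elt_class; apply/spanZ/block_units_span.
by rewrite xv yv.
Qed.

Lemma entry_unit_ideal x y (a : L) :
  entry_class x = entry_class y -> I (a ** entry_unit x y).
Proof.
move=> xy; rewrite /entry_unit numulA -entry_elt_class [a ** _]numulA.
exact/line_ideal/entry_class_line.
Qed.

(** A nonzero multiple of [entry_unit x y] has a nonzero corner, necessarily in column [y];
    rescaling it and changing its row gives back [entry_unit x y]. *)
Lemma entry_unit_minimal x y : entry_class x = entry_class y ->
  minimal_left_ideal [set z : L | exists a, z = a ** entry_unit x y].
Proof.
move=> xy; have mxe := entry_mxunits K E; split.
- split; first by exists 0; rewrite numul0r.
  + by move=> _ _ [a ->] [b ->]; exists (a - b); rewrite numulBl.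
  + by move=> a _ [b ->]; exists (a ** b); rewrite numulA.
- move=> J0; apply: (mxunits_unit_neq0 mxe xy).
  have : [set z : L | exists a, z = a ** entry_unit x y] (entry_unit x y).
    by exists (entry_unit x x); rewrite (mxunits_mul mxe).
  by rewrite J0.
move=> J [J0 JB JM] Jxy; have [Jz|] := pselect (J `<=` [set 0]).
  by left; apply/seteqP; split=> // _ ->.
move=> /existsNP[z] /not_implyP[Jz z0]; right; apply/seteqP;
  split=> // _ [b ->].
apply: (JM); have [a zE] := Jxy z Jz.
have zy : z ** entry_unit y y = z.
  by rewrite zE -numulA (mxunits_mul mxe).
have zI : I z by rewrite zE; exact: entry_unit_ideal.
have [x' [y' [xy' nz [c c0 cE]]]] := mxunits_neq0_corner mxe zI z0.
have yE : y' = y.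
  apply: contrapT => yy'; apply: nz;
    rewrite -[LHS]numulA -zy -[z ** _ ** _]numulA.
  by rewrite (mxunits_orth mxe) ?numulr0 // => /esym.
subst y'; have -> : entry_unit x y = (c^-1 *:
  entry_unit x x') ** (entry_unit x' x' ** z).
  move: cE; rewrite -numulA zy numulZl => ->.
  rewrite numulZr scalerA mulVf // scale1r (mxunits_mul mxe) //.
  by rewrite xy xy'.
by apply: (JM); apply: (JM).
Qed.

Lemma minimal_left_ideal_sub (J : set L) (y : L) :
  minimal_left_ideal J -> J y -> I y.
Proof.
move=> [[J0 JB JM] _ Jmin] Jy; have [->|y0] := pselect (y = 0);
  first exact: span0.
have ymin : left_minimal y.
  split=> // a ay; have [|z [b ->]|Ja0|JE] := Jmin [set z | exists b,
    z = b ** (a ** y)].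
  - split; first by exists 0; rewrite numul0r.
    + by move=> _ _ [b ->] [c ->]; exists (b - c); rewrite numulBl.
    + by move=> b _ [c ->]; exists (b ** c); rewrite numulA.
  - exact/JM/JM.
  - have [u uE] := local_unit (a ** y).
    have : [set z | exists b, z = b ** (a ** y)] (a ** y) by exists u;
      rewrite uE.
    by rewrite Ja0 => /ay.
  - by move: Jy; rewrite -JE => -[b bE]; exists b.
have [v [a [b abE]]] := left_minimal_vertex ymin.
have vmin : left_minimal (lvertex v).
  have v0 := @lvertex_neq0 K E v; rewrite -abE in v0 *.
  apply: (left_minimal_mulr _ v0); apply: left_minimal_mull => // ay.
  by apply: v0; rewrite ay numul0r.
have lv := minimal_vertex_line vmin.
(* With [a ** y ** b = lvertex v], this multiple of [y] is nonzero, so [y] is recovered from it by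
   minimality; the result visibly contains the line point [v] as a factor. *)
have [|d <-] := ymin.2 (b ** lvertex v ** a).
  move=> dy; apply: (@lvertex_neq0 K E v).
  have : a ** y ** ((b ** lvertex v ** a) ** y) ** b = lvertex v.
    rewrite !numulA abE lvertex_idem -[lvertex v ** a ** y]numulA.
    by rewrite -[lvertex v ** (a ** y) ** b]numulA abE lvertex_idem.
  by rewrite dy numulr0 numul0r.
have -> : d ** (b ** lvertex v ** a ** y) = d ** b ** lvertex v ** (a ** y).
  by rewrite !numulA.
exact: line_ideal.
Qed.

Lemma socle_span : socle L = I.
Proof.
have [S0 SD SZ _] := socle_closed L.
apply/seteqP; split=> [_ [s sP ->]|a].
  elim: s sP => [|y s IH] sP; first by rewrite big_nil; exact: span0.
  rewrite big_cons; apply: spanD; last by apply: IH => z zs; apply: sP;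
    rewrite inE zs orbT.
  have [J Jmin Jy] := sP y (mem_head _ _);
    exact: minimal_left_ideal_sub Jmin Jy.
elim=> [//|c _ z [x [y [xy ->]]] _ Sz]; apply: SD => //; apply: SZ.
exists [:: entry_unit x y]; last by rewrite big_seq1.
move=> b; rewrite mem_seq1 => /eqP {b}->;
  exists [set z | exists a, z = a ** entry_unit x y].
  exact: entry_unit_minimal.
by exists (entry_unit x x); rewrite (mxunits_mul (entry_mxunits K E)).
Qed.

End Socle.

Theorem theorem5p6 (K : fieldType) (E : graph) :
  (socle (leavitt K E) = [set 0] \/
   locally_matricial (socle_alg (leavitt K E))) /\
  exists (I : countType) (n : I -> option nat),
    (forall i, n i <> Some 0%N) /\
    nualg_isom (socle_alg (leavitt K E)) (dirsum (fun i => matalg K (n i))).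
Proof.
have Se x y : entry_class K x = entry_class K y -> socle (leavitt K E)
  (entry_unit K x y).
  by move=> xy; rewrite socle_span; exact: block_units_span.
have mxe := subalg_mxunits (socle_closed (leavitt K E)) Se (entry_mxunits K E).
have gene := @span_subalg_units _ _ _ (socle_closed (leavitt K E)) _ _ _ _ Se
  (fun a Sa => eq_ind _ (fun S : set _ => S a) Sa _ (socle_span K E)).
split; last exact: mxunits_classification mxe gene.
(* Matricial algebras are nonzero here, so the stages need an index [x0]; without entries the
   spanning set is empty and the socle is zero. *)
have [[x0 _]|noX] := pselect (exists x : entry_path E, True).
  by right; exact: mxunits_locally_matricial mxe gene x0.
left; rewrite socle_span; apply/seteqP; split=> a; last by move=> ->;
  exact: span0.
by elim=> // c b z [x _] _ _; case: noX; exists x.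
Qed.
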